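(* For all $k\ge4$ and all $\theta\in\mathcal P^k\setminus\mathcal P^k_{\mathrm s}$, the lower quantum functional $F_\theta$ is not a spectral point for $k$-tensors, i.e. $F_\theta\notin\mathcal X(\mathcal T^k)$.
   Context: **Tensors and spectral points.** $\mathcal T^k=\bigcup_{d_1,\dots,d_k\in\mathbb N}(\mathbb C^{d_1}\otimes\cdots\otimes\mathbb C^{d_k})\setminus\{0\}$ is the set of nonzero complex $k$-tensors, with direct sum $\oplus$ as addition and Kronecker product $\boxtimes$ (the tensor product regrouped legwise into a $k$-tensor in $\bigotimes_i(\mathbb C^{d_i}\otimes\mathbb C^{d_i'})$) as multiplication. The rank-$n$ unit $k$-tensor is $\mathsf U_n^k=\sum_{i=1}^n e_i\otimes\cdots\otimes e_i\in(\mathbb C^n)^{\otimes k}$. The tensor $\psi$ restricts to $\varphi$, written $\varphi\le\psi$, if $\varphi=(M_1\otimes\cdots\otimes M_k)\psi$ for some matrices $M_j$. A spectral point of $\mathcal T^k$ is a function $F:\mathcal T^k\to\mathbb R_{\ge1}$ that is monotone under $\le$ ($\varphi\le\psi\Rightarrow F(\varphi)\le F(\psi)$), additive under $\oplus$, multiplicative under $\boxtimes$, and satisfies $F(\mathsf U^k_1)=1$ (hence $F(\mathsf U^k_n)=n$). $\mathcal X(\mathcal T^k)$ is the set of all spectral points. **Distributions.** A bipartition of $[k]=\{1,\dots,k\}$ is an unordered pair $b=\{S,\overline S\}$ with $\emptyset\ne S\subsetneq[k]$, $\overline S=[k]\setminus S$; it is a singleton bipartition if $S$ or $\overline S$ has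 one element. $\mathcal P^k$ is the set of probability distributions on bipartitions of $[k]$, and $\mathcal P^k_{\mathrm s}$ the subset of those supported only on singleton bipartitions. **Lower quantum functional.** Let $V=V_1\otimes\cdots\otimes V_k$ with $V_i=\mathbb C^{d_i}$ with the standard inner product, and $V_S=\bigotimes_{i\in S}V_i$. For $0\ne\psi\in V$ and $b=\{S,\overline S\}$, let $\psi_S:V_{\overline S}^*\to V_S$ be the flattening, $\rho_S=\psi_S\psi_S^*/\|\psi\|_2^2$, and $H_b(\psi)$ the von Neumann entropy (base 2) of $\rho_S$ (independent of the chosen side). Put $H_\theta(\psi)=\sum_b\theta(b)H_b(\psi)$, $E_\theta(\psi)=\sup_{A_j\in\mathrm{GL}(V_j)}H_\theta((A_1\otimes\cdots\otimes A_k)\psi)$, and $F_\theta(\psi)=2^{E_\theta(\psi)}$. *)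

(* Defs.v *)
From HB Require Import structures.
From mathcomp Require Import all_boot all_order all_algebra.
From mathcomp Require Import spectral sesquilinear.
From mathcomp Require Import complex mxtens.
From mathcomp Require Import all_classical all_reals all_analysis.

Set Implicit Arguments.
Unset Strict Implicit.
Unset Printing Implicit Defensive.

Import Order.TTheory GRing.Theory Num.Theory.
Local Open Scope ring_scope.
Local Open Scope complex_scope.
Local Open Scope sesquilinear_scope.

(* A tensor in the tensor product of the C^(d i), i : I, is given by its
   coordinates in the standard basis, indexed by the multi-indices below.
   The legs are indexed by any finite type, so that this also covers V_S. *)
Definition multi_index (I : finType) (d : I -> nat) : Type :=
  {dffun forall i, 'I_(d i)}.
HB.instance Definition _ I d := Finite.on (@multi_index I d).

Notation tensor R d := {ffun multi_index d -> R[i]}.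

Section Operations.
Variables (R : realType) (I : finType).
Implicit Types d e : I -> nat.

(* (M_1 (x) ... (x) M_k) psi, the matrices acting on column vectors. *)
Definition tact d e (M : forall i, 'M[R[i]]_(e i, d i)) (psi : tensor R d) :
    tensor R e :=
  [ffun m : multi_index e =>
     \sum_(l : multi_index d) (\prod_i M i (m i) (l i)) * psi l].

Definition restricts d e (phi : tensor R e) (psi : tensor R d) : Prop :=
  exists M : forall i, 'M[R[i]]_(e i, d i), phi = tact M psi.

Definition lshift_index d e (l : multi_index d) :
    multi_index (fun i => d i + e i)%N :=
  [ffun i => lshift (e i) (l i)].

Definition rshift_index d e (m : multi_index e) :
    multi_index (fun i => d i + e i)%N :=
  [ffun i => rshift (d i) (m i)].

(* Block diagonal.  The two families of shifted multi-indices are injective,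
   and they are disjoint as soon as there is at least one leg. *)
Definition tdsum d e (psi : tensor R d) (phi : tensor R e) :
    tensor R (fun i => d i + e i)%N :=
  [ffun n : multi_index (fun i => d i + e i)%N =>
     if [pick l | lshift_index e l == n] is Some l then psi l
     else if [pick m | rshift_index d m == n] is Some m then phi m
     else 0 : R[i]].

(* C^m (x) C^n is identified with C^(m * n) through [mxtens_index]. *)
Definition tkron d e (psi : tensor R d) (phi : tensor R e) :
    tensor R (fun i => d i * e i)%N :=
  [ffun n : multi_index (fun i => d i * e i)%N =>
     psi [ffun i => (mxtens_unindex (n i)).1]
     * phi [ffun i => (mxtens_unindex (n i)).2]].

Definition tunit (n : nat) : tensor R (fun _ : I => n) :=
  [ffun l : multi_index (fun _ : I => n) =>
     \sum_(r < n) [forall i, l i == r]%:R].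

Lemma tensor_neq0P d (psi : tensor R d) :
  reflect (exists l, psi l != 0) (psi != 0).
Proof.
apply: (iffP idP) => [psi0|[l pl]]; last first.
  by apply: contraNneq pl => ->; rewrite ffunE.
apply/existsP; apply: contraNT psi0 => /existsPn psi0.
by apply/eqP/ffunP => l; rewrite ffunE; apply/eqP/negPn/psi0.
Qed.

Lemma tdsum_neq0 d e (psi : tensor R d) (phi : tensor R e) :
  psi != 0 -> tdsum psi phi != 0.
Proof.
move=> /tensor_neq0P[l pl]; apply/tensor_neq0P; exists (lshift_index e l).
rewrite ffunE; case: pickP => [l' /eqP ll'|/(_ l)]; last by rewrite eqxx.
suff -> : l' = l by [].
apply/ffunP => i; have := congr1 (fun f : multi_index _ => f i) ll'.
by rewrite !ffunE => /lshift_inj.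
Qed.

Lemma tkron_neq0 d e (psi : tensor R d) (phi : tensor R e) :
  psi != 0 -> phi != 0 -> tkron psi phi != 0.
Proof.
move=> /tensor_neq0P[l pl] /tensor_neq0P[m pm]; apply/tensor_neq0P.
exists [ffun i => mxtens_index (l i, m i)]; rewrite ffunE.
rewrite (_ : [ffun i => _] = l); last first.
  by apply/ffunP => i; rewrite !ffunE mxtens_indexK.
rewrite (_ : [ffun i => _] = m); last first.
  by apply/ffunP => i; rewrite !ffunE mxtens_indexK.
by rewrite mulf_neq0.
Qed.

Lemma tunit_neq0 (n : nat) : (0 < n)%N -> tunit n != 0.
Proof.
case: n => // n _; apply/tensor_neq0P; exists [ffun=> ord0]; rewrite ffunE.
rewrite big_ord_recl (_ : [forall i, _] = true); last first.
  by apply/forallP => i; rewrite ffunE.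
by rewrite -natr_sum -natrD add1n pnatr_eq0.
Qed.

End Operations.

(* The set T^k of nonzero complex k-tensors. *)
Record ktensor (R : realType) (k : nat) := KTensor {
  kdim : 'I_k -> nat;
  ktens : tensor R kdim;
  ktens_neq0 : ktens != 0
}.

Section SpectralPoints.
Variables (R : realType) (k : nat).
Implicit Types x y : ktensor R k.

Definition kadd x y : ktensor R k :=
  KTensor (tdsum_neq0 (ktens y) (ktens_neq0 x)).

Definition kmul x y : ktensor R k :=
  KTensor (tkron_neq0 (ktens_neq0 x) (ktens_neq0 y)).

Definition kunit (n : nat) (n_gt0 : (0 < n)%N) : ktensor R k :=
  KTensor (tunit_neq0 R 'I_k n_gt0).

Definition kle x y : Prop := restricts (ktens x) (ktens y).

Record spectral_point (F : ktensor R k -> R) : Prop := SpectralPoint {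
  spectral_ge1 : forall x, 1 <= F x;
  spectral_mono : forall x y, kle x y -> F x <= F y;
  spectral_add : forall x y, F (kadd x y) = F x + F y;
  spectral_mul : forall x y, F (kmul x y) = F x * F y;
  spectral_unit : F (kunit (ltn0Sn 0)) = 1
}.

End SpectralPoints.

Section Distributions.
Variables (R : realType) (k : nat).

(* The unordered pair {S, ~S} is the set of sets [set S; ~: S]. *)
Definition is_bipartition (b : {set {set 'I_k}}) : bool :=
  [exists S : {set 'I_k}, [&& S != finset.set0, S != finset.setT & b == [set S; ~: S]]].

Definition bipartition : Type := {b : {set {set 'I_k}} | is_bipartition b}.
HB.instance Definition _ := Finite.on bipartition.

Definition singleton_bipartition (b : bipartition) : bool :=
  [exists S in val b, #|S| == 1%N].

Definition distributions : set (bipartition -> R) :=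
  [set theta | (forall b, 0 <= theta b) /\ \sum_b theta b = 1]%classic.

Definition singleton_distributions : set (bipartition -> R) :=
  [set theta | distributions theta /\
     forall b, theta b != 0 -> singleton_bipartition b]%classic.

End Distributions.
Arguments distributions : clear implicits.
Arguments singleton_distributions : clear implicits.

Section Entropy.
Variable R : realType.

(* Von Neumann entropy (base 2) of a density matrix, computed from its
   eigenvalues; 0 * log 0 = 0 holds automatically. *)
Definition von_neumann_entropy (n : nat) (rho : 'M[R[i]]_n) : R :=
  - \sum_(j < n) let p := complex.Re (spectral_diag rho 0 j) in
                 p * (ln p / ln 2).

Variables (I : finType) (d : I -> nat).
Implicit Types (S : {set I}) (psi : tensor R d).

Definition leg S : Type := {i : I | i \in S}.
HB.instance Definition _ S := Finite.on (leg S).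

Definition leg_dim S : leg S -> nat := fun i => d (val i).

Lemma notin_setC S (i : I) : i \notin S -> i \in ~: S.
Proof. by rewrite finset.in_setC. Qed.

Definition merge_index S (a : multi_index (@leg_dim S))
    (b : multi_index (@leg_dim (~: S))) : multi_index d :=
  [ffun i => match boolP (i \in S) with
             | AltTrue iS => a (exist _ i iS)
             | AltFalse iS => b (exist _ i (notin_setC iS))
             end].

(* Matrix of the flattening V_(~S)^* -> V_S in the standard bases. *)
Definition flattening S psi :
    'M[R[i]]_(#|{: multi_index (@leg_dim S)}|, #|{: multi_index (@leg_dim (~: S))}|) :=
  \matrix_(a, b) psi (merge_index (enum_val a) (enum_val b)).

Definition norm2sq psi : R[i] := \sum_l `|psi l| ^+ 2.

Definition reduced_density S psi : 'M[R[i]]_#|{: multi_index (@leg_dim S)}| :=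
  (norm2sq psi)^-1 *: (flattening S psi *m (flattening S psi)^t*).

Definition side_entropy S psi : R := von_neumann_entropy (reduced_density S psi).

End Entropy.

Section Functional.
Variables (R : realType) (k : nat).
Implicit Types (theta : bipartition k -> R) (d : 'I_k -> nat).

(* The two sides of b give the same entropy for psi != 0, because rho_S and
   rho_(~S) have the same nonzero eigenvalues; one side is picked. *)
Definition bip_entropy d (b : bipartition k) (psi : tensor R d) : R :=
  if [pick A in val b] is Some A then side_entropy A psi else 0.

Definition mean_entropy theta d (psi : tensor R d) : R :=
  \sum_b theta b * bip_entropy b psi.

(* [sup] is the real supremum; the set is nonempty (identity matrices) and
   bounded above, each bipartition entropy being at most log2 (\prod_i d i). *)
Definition max_entropy theta d (psi : tensor R d) : R :=
  sup [set h | exists2 A : forall i, 'M[R[i]]_(d i),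
                 (forall i, A i \in unitmx) & h = mean_entropy theta (tact A psi)]%classic.

Definition lower_functional theta (x : ktensor R k) : R :=
  2 `^ max_entropy theta (ktens x).

End Functional.

(* Main.v *)
Require Import Defs.
From mathcomp Require Import all_boot all_order all_algebra.
From mathcomp Require Import spectral sesquilinear.
From mathcomp Require Import complex mxtens.
From mathcomp Require Import all_classical all_reals all_analysis.
From mathcomp Require Import ring lra.

(**
Let b0 = {T, ~T} be a bipartition with theta(b0) > 0 and at least two legs on
each side.  Take i1, i2 outside T and i3, i4 inside T, let q be a large integer
and p = 1 / q.

Let D ([crossed]) be the product of an EPR pair between i1 and i3 with an EPR
pair between i2 and i4, one of its four amplitudes being lowered to p.  Lowering
it makes the orbit of D defective: for every psi in the orbit there is a vector v
on the legs T with <v, rho_T(psi) v> <= p |v|^2 ([small_vector]).  Nevertheless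
the flattening of psi has rank four, so a joint operator on the legs i1 and i2
turns psi into a product of v and a vector on ~T.  Such an operator is a sum of
two local ones, hence can be carried out with an EPR pair of rank two between i1
and i2 ([graft_exists]).

So the tensor psi (x) EPR, with an EPR pair of rank q + 1 between i1 and i2,
restricts to a sum Psi of q orthogonal branches that are marked by a flag held by
both i1 and i2: psi itself in q - 1 of them, and the product tensor, the graft,
in the last one ([restricts_flag_sum]).  Compare the entropies of Psi and psi.
- A side that separates i1 from i2 sees the flag: its entropy is log q plus the
  mean of the entropies of the branches ([side_entropy_flags_cut]).
- On a side that avoids i1 and i2 the reduced density of Psi is the mixture
  (1 - p) rho + p sigma of those of psi and of the graft.  Its entropy is at least
  (1 - p) H(rho) - p log tr(sigma ((1 - p) rho + p sigma)) ([entropy_mix]), which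
  costs O(p) in general.  On T, though, sigma is the projection on v, so the trace
  is at most 2p and the entropy gains p log (q / 2).

Let t be the theta-mass of the bipartitions that separate i1 from i2.  Counting
dimensions, F(EPR) <= (q + 1)^t, and log (q + 1) - log q is O(p).  If F were
monotone and multiplicative, then F(Psi) <= F(D) F(EPR); for psi close to the
supremum that defines F(D), dividing the logarithms by p leaves
theta(b0) log (q / 2) <= k + 2 + 1 / ln 2 ([spectral_inequality]), which is false
for large q.
*)

Set Implicit Arguments.
Unset Strict Implicit.
Unset Printing Implicit Defensive.

Import Order.TTheory GRing.Theory Num.Theory.
Local Open Scope ring_scope.
Local Open Scope complex_scope.
Local Open Scope sesquilinear_scope.

(** * Sums over the spectrum of a matrix *)

(** Sylvester's identity: both sides are the determinant of the block matrix
    [X, A; B, 1], times X^n, computed by column operations in two ways. *)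
Lemma char_poly_mulC (R : comNzRingType) m n (A : 'M[R]_(m, n)) (B : 'M[R]_(n, m)) :
  char_poly (A *m B) * 'X^n = char_poly (B *m A) * 'X^m.
Proof.
pose a : 'M[{poly R}]_(m, n) := map_mx polyC A.
pose b : 'M[{poly R}]_(n, m) := map_mx polyC B.
pose M := block_mx 'X%:M a b 1%:M.
have e1 : M *m block_mx 1%:M 0 (- b) 1%:M =
          block_mx ('X%:M - a *m b) a 0 1%:M.
  by rewrite mulmx_block !mulmx1 !mul1mx !mulmx0 mulmxN !add0r subrr.
have e2 : M *m block_mx 1%:M (- a) 0 'X%:M =
          block_mx 'X%:M 0 b ('X%:M - b *m a).
  rewrite mulmx_block !mulmx1 !mul1mx !mulmx0 !mulmxN !addr0.
  by rewrite mul_mx_scalar mul_scalar_mx addNr addrC.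
have := congr1 determinant e2; have := congr1 determinant e1.
rewrite !det_mulmx !det_ublock !det_lblock !det1 !det_scalar !mul1r !mulr1.
by move=> e1d e2d; rewrite /char_poly /char_poly_mx !map_mxM /= -e1d e2d mulrC.
Qed.

(** If A B = 0 then (X - A)(X - B) = X (X - (A + B)). *)
Lemma char_poly_orthoD (R : comNzRingType) n (A B : 'M[R]_n) :
  A *m B = 0 -> char_poly A * char_poly B = char_poly (A + B) * 'X^n.
Proof.
move=> AB; rewrite /char_poly -det_mulmx -[in RHS](det_scalar n 'X) -det_mulmx.
congr (\det _); rewrite /char_poly_mx mulmxBl !mulmxBr -map_mxM AB map_mx0.
rewrite subr0 mulmxBl map_mxD mulmxDl !mul_mx_scalar !mul_scalar_mx.
by rewrite opprD addrA addrAC.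
Qed.

Section SpectralSum.
Variables (C : numClosedFieldType) (V : zmodType).

Lemma char_poly_spectral n (A : 'M[C]_n) : A \is normalmx ->
  char_poly A = \prod_j ('X - (spectral_diag A 0 j)%:P).
Proof.
move=> /orthomx_spectralP {1}->.
set P := spectralmx A; set d := spectral_diag A.
have P1 : P \in unitmx by exact: spectral_unit.
have /mulIf inj : ('X^n : {poly C}) != 0 by rewrite expf_neq0 ?polyX_eq0.
apply: inj; rewrite -mulmxA char_poly_mulC -mulmxA mulmxV // mulmx1 char_poly_trig; last first.
  exact: diag_mx_is_trig.
by congr (_ * _); apply: eq_bigr => j _; rewrite mxE eqxx.
Qed.

Definition spectral_sum (f : C -> V) n (A : 'M[C]_n) : V :=
  \sum_j f (spectral_diag A 0 j).

Variable f : C -> V.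
Hypothesis f0 : f 0 = 0.

(** A function that vanishes at 0 does not see the powers of X by which two
    characteristic polynomials may differ.  This is what makes entropy insensitive
    to the dimension of the ambient space. *)
Lemma spectral_sum_roots n (A : 'M[C]_n) (s : seq C) k l : A \is normalmx ->
  char_poly A * 'X^k = \prod_(x <- s) ('X - x%:P) * 'X^l ->
  spectral_sum f A = \sum_(x <- s) f x.
Proof.
move=> /char_poly_spectral ->.
rewrite -(big_map (fun j => spectral_diag A 0 j) xpredT (fun x => 'X - x%:P)).
set r := map _ _.
have Xn i : 'X^i = \prod_(x <- nseq i (0 : C)) ('X - x%:P).
  by rewrite big_nseq subr0 -Monoid.iteropE.
rewrite !Xn -!big_cat /= => /prod_XsubC_eq e.
have zero i : \sum_(x <- nseq i (0 : C)) f x = 0.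
  by rewrite big_nseq f0; elim: i => //= i ->; rewrite addr0.
have : \sum_(x <- r ++ nseq k 0) f x = \sum_(x <- s ++ nseq l 0) f x.
  exact: perm_big e.
rewrite !big_cat /= !zero !addr0 => <-.
by rewrite /r big_map.
Qed.

Lemma spectral_sum_eq m n (A : 'M[C]_m) (B : 'M[C]_n) :
  A \is normalmx -> B \is normalmx ->
  char_poly A * 'X^n = char_poly B * 'X^m ->
  spectral_sum f A = spectral_sum f B.
Proof.
move=> Ah Bh e.
rewrite (@spectral_sum_roots _ A [seq spectral_diag B 0 j | j <- index_enum _] n m) //.
  by rewrite big_map.
by rewrite big_map -char_poly_spectral.
Qed.

Lemma spectral_sum_mulC m n (A : 'M[C]_(m, n)) (B : 'M[C]_(n, m)) :
  A *m B \is normalmx -> B *m A \is normalmx ->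
  spectral_sum f (A *m B) = spectral_sum f (B *m A).
Proof. by move=> *; apply: spectral_sum_eq => //; exact: char_poly_mulC. Qed.

Lemma spectral_sum_trmx n (A : 'M[C]_n) : A \is normalmx -> A^T \is normalmx ->
  spectral_sum f A^T = spectral_sum f A.
Proof.
move=> *; apply: spectral_sum_eq => //; congr (_ * _).
by rewrite /char_poly -det_tr /char_poly_mx linearB /= tr_scalar_mx -map_trmx trmxK.
Qed.

Lemma spectral_sum_orthoD n (A B : 'M[C]_n) : A *m B = 0 ->
  A \is normalmx -> B \is normalmx -> A + B \is normalmx ->
  spectral_sum f (A + B) = spectral_sum f A + spectral_sum f B.
Proof.
move=> AB Ah Bh ABh.
rewrite (@spectral_sum_roots _ (A + B)
  ([seq spectral_diag A 0 j | j <- index_enum _] ++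
   [seq spectral_diag B 0 j | j <- index_enum _]) n 0) //.
  by rewrite big_cat !big_map.
rewrite big_cat !big_map expr0 mulr1 -(char_poly_orthoD AB).
by rewrite !char_poly_spectral.
Qed.

End SpectralSum.

(** * Gibbs inequalities for real weights *)

Section Gibbs.
Variable R : realType.
Implicit Types x y : R.

Lemma ln_le_tangent x c : 0 < x -> 0 < c -> ln x <= ln c + x / c - 1.
Proof.
move=> x0 c0; have xc : 0 < x / c by rewrite divr_gt0.
have : ln (1 + (x / c - 1)) <= x / c - 1 by apply: le_ln1Dx; lra.
by rewrite addrC subrK ln_div ?posrE //; lra.
Qed.

Lemma gibbs_pointwise x y : 0 <= x -> 0 < y -> x - y <= x * ln x - x * ln y.
Proof.
rewrite le_eqVlt => /predU1P[<- y0|x0 y0]; first by rewrite !mul0r; lra.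
have := ler_wpM2l (ltW x0) (ln_le_tangent y0 x0).
rewrite mulrBr mulrDr mulr1 mulrC [x * (y / x)]mulrC divfK ?gt_eqF //; lra.
Qed.

Lemma entropy_le_ln (J : finType) (l : J -> R) :
  (forall j, 0 <= l j) -> \sum_j l j = 1 ->
  \sum_j - (l j * ln (l j)) <= ln #|J|%:R.
Proof.
move=> l0 l1; have J0 : 0 < #|J|%:R :> R.
  rewrite ltr0n lt0n; apply: contra_eq_neq l1 => J0.
  rewrite big_pred0 1?eq_sym ?oner_neq0 // => j.
  by have := card0_eq J0 j; rewrite inE.
have : \sum_j (l j - #|J|%:R^-1) <= \sum_j (l j * ln (l j) - l j * ln #|J|%:R^-1).
  by apply: ler_sum => j _; apply: gibbs_pointwise; rewrite ?invr_gt0.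
rewrite !sumrB sumrN sumr_const -mulr_suml l1 mul1r lnV // opprK.
rewrite -(mulr_natl _^-1) divff ?gt_eqF // subrr; lra.
Qed.

(** The scalar form of Klein's inequality for a mixture.  Here l and g are the
    spectra of rho and of the mixture, D j i is the squared overlap of their
    eigenvectors, and s is the diagonal of sigma in the eigenbasis of the mixture.
    The first part of the sum is compared with l by Gibbs' inequality, the second
    one by the concavity of ln. *)
Lemma gibbs_mix (I J : finType) (l : I -> R) (D : J -> I -> R) (s : J -> R) p c :
  (forall i, 0 <= l i) -> \sum_i l i = 1 ->
  (forall j i, 0 <= D j i) -> (forall i, \sum_j D j i = 1) ->
  (forall j, \sum_i D j i = 1) ->
  (forall j, 0 <= s j) -> \sum_j s j = 1 ->
  0 < p -> p < 1 -> 0 < c ->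
  let g j := (1 - p) * \sum_i D j i * l i + p * s j in
  \sum_j s j * g j <= c ->
  (1 - p) * (\sum_i - (l i * ln (l i))) - p * ln c <= \sum_j - (g j * ln (g j)).
Proof.
move=> l0 l1 D0 Dc Dr s0 s1 p0 p1 c0 g sg.
have q0 : 0 < 1 - p by rewrite subr_gt0.
have Dl0 j i : 0 <= D j i * l i by rewrite mulr_ge0.
have a0 j : 0 <= \sum_i D j i * l i by rewrite sumr_ge0.
have g0 j : 0 <= g j by rewrite addr_ge0 // mulr_ge0 // (ltW p0, ltW q0).
have sum_a : \sum_j \sum_i D j i * l i = 1.
  rewrite exchange_big /= -[RHS]l1; apply: eq_bigr => i _.
  by rewrite -mulr_suml Dc mul1r.
have sum_g : \sum_j g j = 1.
  by rewrite big_split /= -!mulr_sumr sum_a s1; lra.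
have gP j : g j = 0 -> (forall i, D j i * l i = 0) /\ s j = 0.
  have [q0' p0'] := (ltW q0, ltW p0).
  move=> /eqP; rewrite paddr_eq0 ?mulr_ge0 //.
  rewrite !mulf_eq0 (gt_eqF q0) (gt_eqF p0) /= => /andP[/eqP a /eqP ->]; split=> // i.
  by have /psumr_eq0P -> := a.
have -> : \sum_j - (g j * ln (g j)) =
    (1 - p) * (\sum_j \sum_i - (D j i * l i * ln (g j))) +
    p * \sum_j - (s j * ln (g j)).
  rewrite !mulr_sumr -big_split /=; apply: eq_bigr => j _.
  by rewrite sumrN -mulr_suml /g; lra.
apply: lerD; last rewrite -mulrN ler_pM2l //.
  rewrite ler_pM2l // -subr_ge0.
  have -> : \sum_i - (l i * ln (l i)) = \sum_j \sum_i - (D j i * l i * ln (l i)).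
    rewrite exchange_big /=; apply: eq_bigr => i _.
    by rewrite sumrN -!mulr_suml Dc mul1r.
  rewrite -sumrB.
  apply: (@le_trans _ _ (\sum_j ((\sum_i D j i * l i) - g j))).
    by rewrite sumrB sum_a sum_g subrr.
  apply: ler_sum => j _; rewrite -sumrB.
  have -> : (\sum_i D j i * l i) - g j = \sum_i (D j i * (l i - g j)).
    under [in RHS]eq_bigr do rewrite mulrBr.
    by rewrite sumrB -mulr_suml Dr mul1r.
  apply: ler_sum => i _.
  have [gj|gj] := eqVneq (g j) 0.
    by have [Dl _] := gP _ gj; rewrite gj subr0 Dl !mul0r subrr.
  have gj0 : 0 < g j by rewrite lt_neqAle eq_sym gj g0.
  have := ler_wpM2l (D0 j i) (gibbs_pointwise (l0 i) gj0).
  by rewrite !mulrBr !mulrA; lra.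
have : \sum_j s j * ln (g j) <= \sum_j (s j * (ln c - 1) + s j * g j / c).
  apply: ler_sum => j _; have [gj|gj] := eqVneq (g j) 0.
    by have [_ ->] := gP _ gj; rewrite !mul0r addr0.
  have gj0 : 0 < g j by rewrite lt_neqAle eq_sym gj g0.
  have := ler_wpM2l (s0 j) (ln_le_tangent gj0 c0).
  by rewrite -mulrA -mulrDr; congr (_ <= _ * _); lra.
rewrite big_split /= -!mulr_suml s1 mul1r sumrN.
have : (\sum_j s j * g j) / c <= 1 by rewrite ler_pdivrMr // mul1r.
lra.
Qed.

End Gibbs.

(** * Positive semidefinite matrices and the entropy of a mixture *)

Section Adjoint.
Variable C : numClosedFieldType.

Lemma ctmxM m n p (A : 'M[C]_(m, n)) (B : 'M[C]_(n, p)) :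
  (A *m B)^t* = B^t* *m A^t*.
Proof. by rewrite trmx_mul map_mxM. Qed.

Lemma ctmx1 n : (1%:M : 'M[C]_n)^t* = 1%:M.
Proof. by rewrite trmx1 map_mx1. Qed.

Lemma ctmxZ m n c (A : 'M[C]_(m, n)) : (c *: A)^t* = c^* *: A^t*.
Proof. by apply/matrixP => i j; rewrite !mxE rmorphM. Qed.

Lemma ctmxD m n (A B : 'M[C]_(m, n)) : (A + B)^t* = A^t* + B^t*.
Proof. by apply/matrixP => i j; rewrite !mxE rmorphD. Qed.

Definition psdmx n (A : 'M[C]_n) : Prop :=
  A^t* = A /\ forall u : 'rV[C]_n, 0 <= (u *m A *m u^t*) 0 0.

Lemma mul_adj_ge0 n (u : 'rV[C]_n) : 0 <= (u *m u^t*) 0 0.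
Proof.
by rewrite !mxE sumr_ge0 // => j _; rewrite !mxE -normCK exprn_ge0.
Qed.

Lemma psd_gram m n (A : 'M[C]_(m, n)) : psdmx (A *m A^t*).
Proof.
split=> [|u]; first by rewrite ctmxM trmxCK.
by rewrite -!mulmxA -ctmxM mulmxA mul_adj_ge0.
Qed.

Lemma psd_conj m n (K : 'M[C]_(m, n)) A : psdmx A -> psdmx (K *m A *m K^t*).
Proof.
move=> [Ah A0]; split=> [|u]; first by rewrite !ctmxM trmxCK Ah mulmxA.
by have := A0 (u *m K); rewrite ctmxM !mulmxA.
Qed.

Lemma psdD n (A B : 'M[C]_n) : psdmx A -> psdmx B -> psdmx (A + B).
Proof.
move=> [Ah A0] [Bh B0]; split=> [|u]; first by rewrite ctmxD Ah Bh.
by rewrite mulmxDr mulmxDl mxE addr_ge0.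
Qed.

Lemma psdZ n c (A : 'M[C]_n) : 0 <= c -> psdmx A -> psdmx (c *: A).
Proof.
move=> c0 [Ah A0]; split=> [|u].
  by rewrite ctmxZ Ah (CrealP _) // ger0_real.
by rewrite -scalemxAr -scalemxAl mxE mulr_ge0.
Qed.

Lemma psd_sum (I : finType) n (A : I -> 'M[C]_n) :
  (forall i, psdmx (A i)) -> psdmx (\sum_i A i).
Proof.
move=> A0; apply: (big_ind (@psdmx n)) => //; last exact: psdD.
by rewrite -[0](scale0r 1%:M); apply: psdZ => //; rewrite -[1%:M]mulmx1 -[X in _ *m X]ctmx1; exact: psd_gram.
Qed.

Lemma psd_normal n (A : 'M[C]_n) : psdmx A -> A \is normalmx.
Proof. by move=> [Ah _]; apply/normalmxP; rewrite Ah. Qed.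

Lemma psd_diag_ge0 n (A : 'M[C]_n) j : psdmx A -> 0 <= A j j.
Proof.
move=> [_ /(_ (delta_mx 0 j))]; rewrite -rowE.
rewrite mxE (bigD1 j) //= big1 ?addr0 => [|i ij]; rewrite !mxE.
  by rewrite !eqxx /= conjC1 mulr1.
by rewrite (negPf ij) andbF conjC0 mulr0.
Qed.

Lemma spectral_conj n (A : 'M[C]_n) (P := spectralmx A) : A \is normalmx ->
  P *m A *m P^t* = diag_mx (spectral_diag A).
Proof.
move=> /orthomx_spectralP {1}->; rewrite -/P.
have P1 : P \in unitmx by exact: spectral_unit.
rewrite -invmx_unitary ?spectral_unitarymx // -!mulmxA mulmxV //.
by rewrite mulmx1 mulKVmx.
Qed.

Lemma psd_spectral_ge0 n (A : 'M[C]_n) j : psdmx A -> 0 <= spectral_diag A 0 j.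
Proof.
move=> A0; have := psd_diag_ge0 j (psd_conj (spectralmx A) A0).
by rewrite spectral_conj ?psd_normal // mxE eqxx.
Qed.

Lemma trace_spectral n (A : 'M[C]_n) : A \is normalmx ->
  \tr A = \sum_j spectral_diag A 0 j.
Proof.
move=> An; rewrite -mxtrace_diag -spectral_conj // mxtrace_mulC mulmxA.
by rewrite -invmx_unitary ?spectral_unitarymx // mulVmx ?mul1mx // spectral_unit.
Qed.

End Adjoint.

Section Entropy.
Variable R : realType.
Local Notation C := R[i].
Local Notation H := von_neumann_entropy.
Local Notation Re := complex.Re.

Definition shannon (x : C) : R := - (Re x * (ln (Re x) / ln 2)).

Lemma shannon0 : shannon 0 = 0.
Proof. by rewrite /shannon /= mul0r oppr0. Qed.

Lemma entropyE n (A : 'M[C]_n) : H A = spectral_sum shannon A.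
Proof. by rewrite /von_neumann_entropy -sumrN. Qed.

Lemma ReD (x y : C) : Re (x + y) = Re x + Re y. Proof. by case: x y => [? ?] []. Qed.
Lemma Re_sum (I : finType) (F : I -> C) : Re (\sum_i F i) = \sum_i Re (F i).
Proof. by elim/big_rec2: _ => // i x y _ <-; rewrite ReD. Qed.
Lemma ReZ (x : R) (y : C) : Re (x%:C * y) = x * Re y.
Proof. by case: y => a b /=; rewrite mul0r subr0. Qed.
Lemma Re_ge0 (x : C) : 0 <= x -> 0 <= Re x.
Proof. by rewrite lecE => /andP[]. Qed.
Lemma RRe_ge0 (x : C) : 0 <= x -> (Re x)%:C = x.
Proof. by move=> x0; rewrite RRe_real // ger0_real. Qed.

Lemma psd_Re_sum n (A : 'M[C]_n) : psdmx A -> \tr A = 1 ->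
  \sum_j Re (spectral_diag A 0 j) = 1.
Proof.
by move=> A0 A1; rewrite -Re_sum -trace_spectral ?psd_normal // A1.
Qed.

Lemma ln2_gt0 : 0 < ln 2 :> R.
Proof. by apply: ln_gt0; rewrite ltr1n. Qed.

Lemma entropyE_ln n (A : 'M[C]_n) : H A * ln 2 =
  \sum_j - (Re (spectral_diag A 0 j) * ln (Re (spectral_diag A 0 j))).
Proof.
rewrite entropyE mulr_suml; apply: eq_bigr => j _.
by rewrite /shannon mulNr mulrA divfK // gt_eqF // ln2_gt0.
Qed.

Lemma entropy_le_log n (A : 'M[C]_n) : psdmx A -> \tr A = 1 ->
  H A <= ln n%:R / ln 2.
Proof.
move=> A0 A1; rewrite ler_pdivlMr ?ln2_gt0 // entropyE_ln.
have := @entropy_le_ln _ _ (fun j => Re (spectral_diag A 0 j)) _ (psd_Re_sum A0 A1).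
by rewrite card_ord; apply=> j; apply: Re_ge0; exact: psd_spectral_ge0.
Qed.

Lemma unitarymx_row n (U : 'M[C]_n) j : U \is unitarymx ->
  \sum_i Re (`|U j i| ^+ 2) = 1.
Proof.
move=> /unitarymxP /matrixP/(_ j j); rewrite !mxE eqxx => U1.
rewrite -Re_sum (_ : \sum_i _ = 1) // -[RHS]U1.
by apply: eq_bigr => i _; rewrite !mxE normCK.
Qed.

(** Both terms of H(mix) = - (1 - p) tr(rho log mix) - p tr(sigma log mix) are
    bounded below: the first one by Klein's inequality, the second one by Jensen's.
    The smaller the overlap of sigma with the mixture, the larger the entropy. *)
Lemma entropy_mix n (rho sigma : 'M[C]_n) (p c : R) :
  psdmx rho -> \tr rho = 1 -> psdmx sigma -> \tr sigma = 1 ->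
  0 < p -> p < 1 -> 0 < c ->
  let mix := (1 - p)%:C *: rho + p%:C *: sigma in
  \tr (sigma *m mix) <= c%:C ->
  (1 - p) * H rho - p * (ln c / ln 2) <= H mix.
Proof.
move=> r0 r1 s0 s1 p0 p1 c0 mix sc.
have q0 : 0 < 1 - p by rewrite subr_gt0.
have m0 : psdmx mix by apply: psdD; apply: psdZ => //; rewrite ler0c ltW.
rewrite -(ler_pM2r ln2_gt0) entropyE_ln mulrBl -!mulrA entropyE_ln.
rewrite mulVf ?gt_eqF ?ln2_gt0 // mulr1.
pose P := spectralmx mix; pose Q := spectralmx rho.
pose U := P *m Q^t*.
have PU : P \is unitarymx by exact: spectral_unitarymx.
have QU : Q \is unitarymx by exact: spectral_unitarymx.
have UU : U \is unitarymx by apply: mul_unitarymx; rewrite ?trmxC_unitary.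
have P1 : P^t* *m P = 1%:M.
  by rewrite -invmx_unitary // mulVmx // unitarymx_unit.
pose D j i := Re (`|U j i| ^+ 2).
pose l i := Re (spectral_diag rho 0 i).
pose s j := Re ((P *m sigma *m P^t*) j j).
have sE j : (s j)%:C = (P *m sigma *m P^t*) j j.
  by rewrite /s RRe_ge0 //; apply: psd_diag_ge0; exact: psd_conj.
have D0 j i : 0 <= D j i by rewrite Re_ge0 // exprn_ge0.
have l0 j : 0 <= l j by rewrite Re_ge0 // psd_spectral_ge0.
have s0' j : 0 <= s j by rewrite Re_ge0 //; apply: psd_diag_ge0; exact: psd_conj.
have s1' : \sum_j s j = 1.
  rewrite -[RHS]/(Re 1) -s1 -Re_sum -[\sum_j _]/(\tr _).
  by rewrite mxtrace_mulC mulmxA P1 mul1mx.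
have rhoE : rho = Q^t* *m diag_mx (spectral_diag rho) *m Q.
  by rewrite -invmx_unitary //; exact/orthomx_spectralP/psd_normal.
have aE j : (\sum_i D j i * l i)%:C = (P *m rho *m P^t*) j j.
  rewrite {1}rhoE !mulmxA -/U -mulmxA -[Q *m P^t*]trmxCK ctmxM trmxCK -/U.
  rewrite mxE rmorph_sum /=; apply: eq_bigr => i _.
  rewrite mul_mx_diag !mxE rmorphM /= !RRe_ge0 ?exprn_ge0 // ?psd_spectral_ge0 //.
  have -> : \sum_k P j k * (Q^t*) k i = U j i by rewrite mxE.
  by rewrite normCK mulrAC.
have gE j : Re (spectral_diag mix 0 j) = (1 - p) * \sum_i D j i * l i + p * s j.
  have -> : spectral_diag mix 0 j = (P *m mix *m P^t*) j j.
    by rewrite spectral_conj ?psd_normal // mxE eqxx.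
  have -> : (P *m mix *m P^t*) j j =
      (1 - p)%:C * (P *m rho *m P^t*) j j + p%:C * (P *m sigma *m P^t*) j j.
    rewrite mulmxDr mulmxDl -!scalemxAr -!scalemxAl.
    by rewrite [LHS]mxE; congr (_ + _); rewrite [LHS]mxE.
  by rewrite ReD !ReZ -aE -sE.
under [X in _ <= X]eq_bigr do rewrite gE.
apply: gibbs_mix => //.
- exact: psd_Re_sum.
- move=> i; have := @unitarymx_row _ U^T i.
  rewrite trmx_unitary => /(_ UU) <-; apply: eq_bigr => j _.
  by rewrite /D [U^T i j]mxE.
- by move=> j; exact: unitarymx_row.
rewrite -lecR; apply: le_trans sc.
have mixE : mix = P^t* *m diag_mx (spectral_diag mix) *m P.
  by rewrite -invmx_unitary //; exact/orthomx_spectralP/psd_normal.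
rewrite {1}mixE !mulmxA mxtrace_mulC !mulmxA.
rewrite rmorph_sum /=; apply: ler_sum => j _.
rewrite mul_mx_diag mxE rmorphM /= -gE sE RRe_ge0 //.
exact: psd_spectral_ge0.
Qed.

End Entropy.

(** * Entropy of sums and conjugates *)

Section EntropyInvariance.
Variable R : realType.
Local Notation C := R[i].
Local Notation H := von_neumann_entropy.
Local Notation Re := complex.Re.

Lemma psd_trmx n (A : 'M[C]_n) : psdmx A -> psdmx A^T.
Proof.
move=> [Ah A0]; split=> [|u]; first by rewrite -[in RHS]Ah map_trmx.
have -> : (u *m A^T *m u^t*) 0 0 = ((u *m A^T *m u^t*)^T) 0 0 by rewrite [RHS]mxE.
have e1 : (u^t*)^T = map_mx Num.conj u by rewrite map_trmx trmxK.
have e2 : (map_mx Num.conj u)^t* = u^T by apply/matrixP => i j; rewrite !mxE conjCK.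
by rewrite !trmx_mul trmxK e1 mulmxA -e2.
Qed.

Lemma entropy_isometry m n (K : 'M[C]_(m, n)) A : K^t* *m K = 1%:M ->
  psdmx A -> H (K *m A *m K^t*) = H A.
Proof.
move=> K1 A0; rewrite !entropyE -mulmxA.
have e : A *m K^t* *m K = A by rewrite -mulmxA K1 mulmx1.
rewrite spectral_sum_mulC ?e //; first exact: shannon0.
  by rewrite mulmxA; apply: psd_normal; exact: psd_conj.
exact: psd_normal.
Qed.

(** The two sides of a bipartition have the same entropy: A A^* and A^* A have
    the same nonzero eigenvalues. *)
Lemma entropy_gram_trmx m n (A : 'M[C]_(m, n)) (c : C) : 0 <= c ->
  H (c *: (A *m A^t*)) = H (c *: (A^T *m (A^T)^t*)).
Proof.
move=> c0; rewrite !entropyE scalemxAl.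
have g : c *: (A^T *m (A^T)^t*) = (A^t* *m (c *: A))^T.
  by rewrite trmx_mul linearZ /= -scalemxAl map_trmx trmxK.
have n1 : psdmx (A^t* *m (c *: A)).
  rewrite -scalemxAr; apply: psdZ => //.
  by have := psd_gram (A^t*); rewrite trmxCK.
rewrite spectral_sum_mulC; first last.
- exact: psd_normal.
- by rewrite -scalemxAl; apply: psd_normal; apply: psdZ => //; exact: psd_gram.
- exact: shannon0.
rewrite g spectral_sum_trmx //; first exact: shannon0.
  exact: psd_normal.
by apply: psd_normal; exact: psd_trmx.
Qed.

Lemma entropy0 n : H (0 : 'M[C]_n) = 0.
Proof.
have := @entropy_isometry n 0 0 (0 : 'M[C]_0).
rewrite !(mulmx0, mul0mx). move=> ->; first by rewrite entropyE /spectral_sum big_ord0.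
  by apply/matrixP => -[].
by split=> [|u]; rewrite ?mulmx0 ?mul0mx ?mxE //; apply/matrixP => -[].
Qed.

Lemma entropy_ortho_sum n q (A : 'I_q -> 'M[C]_n) : (forall i, psdmx (A i)) ->
  (forall i j, i != j -> A i *m A j = 0) ->
  H (\sum_i A i) = \sum_i H (A i).
Proof.
elim: q A => [|q IH] A A0 AA; first by rewrite !big_ord0 entropy0.
rewrite !big_ord_recl -IH // => [|i j ij]; last by apply: AA; rewrite (inj_eq lift_inj).
rewrite !entropyE spectral_sum_orthoD //; first exact: shannon0.
- by rewrite mulmx_sumr big1 // => i _; rewrite AA.
- exact: psd_normal.
- by apply: psd_normal; exact: psd_sum.
- by apply: psd_normal; apply: psdD => //; exact: psd_sum.
Qed.

Lemma psd_diag n (d : 'rV[C]_n) : (forall j, 0 <= d 0 j) -> psdmx (diag_mx d).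
Proof.
move=> d0; split=> [|u].
  rewrite tr_diag_mx map_diag_mx; congr diag_mx; apply/rowP => j.
  by rewrite mxE; apply/CrealP; rewrite ger0_real.
rewrite mul_mx_diag mxE sumr_ge0 // => j _.
by rewrite !mxE mulrAC -normCK mulr_ge0 ?exprn_ge0.
Qed.

Lemma entropy_diag n (d : 'rV[C]_n) : (forall j, 0 <= d 0 j) ->
  H (diag_mx d) = \sum_j shannon (d 0 j).
Proof.
move=> d0; rewrite entropyE.
rewrite (@spectral_sum_roots _ _ _ (@shannon0 R) _ _ [seq d 0 j | j <- index_enum _] 0 0).
- by rewrite big_map.
- apply/normalmxP; rewrite tr_diag_mx map_diag_mx; exact: diag_mxC.
rewrite big_map char_poly_trig ?diag_mx_is_trig //; congr (_ * _).
by apply: eq_bigr => j _; rewrite mxE eqxx.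
Qed.

Lemma entropy_scale n (A : 'M[C]_n) (q : nat) : psdmx A -> \tr A = 1 -> (0 < q)%N ->
  H ((q%:R^-1 : C) *: A) = (H A + ln q%:R / ln 2) / q%:R.
Proof.
move=> A0 A1 q0; have qR : 0 < q%:R :> R by rewrite ltr0n.
have qC : 0 <= q%:R^-1 :> C by rewrite invr_ge0 ler0n.
have qE : q%:R^-1 = (q%:R^-1)%:C :> C by rewrite fmorphV rmorph_nat.
pose P := spectralmx A; have PU : P \is unitarymx by exact: spectral_unitarymx.
have AE : A = P^t* *m diag_mx (spectral_diag A) *m (P^t*)^t*.
  by rewrite trmxCK -invmx_unitary //; exact/orthomx_spectralP/psd_normal.
rewrite {1}AE scalemxAl scalemxAr -linearZ /=.
have d0 j : 0 <= (q%:R^-1 *: spectral_diag A) 0 j.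
  by rewrite mxE mulr_ge0 // psd_spectral_ge0.
rewrite entropy_isometry; first last.
- exact: psd_diag.
- by rewrite trmxCK (unitarymxP PU).
rewrite entropy_diag // entropyE /spectral_sum mulrDl [in RHS]mulr_suml.
have -> : ln q%:R / ln 2 / q%:R =
    \sum_j Re (spectral_diag A 0 j) * (ln q%:R / ln 2 / q%:R).
  by rewrite -mulr_suml psd_Re_sum // mul1r.
rewrite -big_split /=; apply: eq_bigr => j _.
rewrite /shannon mxE qE ReZ.
have := Re_ge0 (psd_spectral_ge0 j A0); rewrite le_eqVlt => /predU1P[<-|l0].
  by rewrite mulr0 !mul0r !oppr0 mul0r addr0.
rewrite lnM ?posrE ?invr_gt0 // lnV ?posrE //.
by rewrite mulNr; set l := Re _; set a := ln 2; lra.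
Qed.

Lemma entropy_ge0 n (A : 'M[C]_n) : psdmx A -> \tr A = 1 -> 0 <= H A.
Proof.
move=> A0 A1; rewrite entropyE; apply: sumr_ge0 => j _.
have l0 k := Re_ge0 (psd_spectral_ge0 k A0).
rewrite /shannon oppr_ge0 mulr_ge0_le0 // mulr_le0_ge0 //; last first.
  by rewrite invr_ge0 ltW // ln2_gt0.
apply: ln_le0; rewrite -(psd_Re_sum A0 A1) (bigD1 j) //=.
by rewrite lerDl sumr_ge0.
Qed.

(** Chain rule for the uniform mixture of states with orthogonal ranges. *)
Lemma entropy_flags m n q (X : 'I_q -> 'M[C]_(m, n)) (rho : 'I_q -> 'M[C]_n) :
  (0 < q)%N -> (forall f g, (X f)^t* *m X g = (f == g)%:R%:M) ->
  (forall f, psdmx (rho f)) -> (forall f, \tr (rho f) = 1) ->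
  H (q%:R^-1 *: \sum_f X f *m rho f *m (X f)^t*) =
  (\sum_f H (rho f)) / q%:R + ln q%:R / ln 2.
Proof.
move=> q0 XX r0 r1; have qR : q%:R != 0 :> R by rewrite pnatr_eq0 -lt0n.
have qC : 0 <= q%:R^-1 :> C by rewrite invr_ge0 ler0n.
rewrite scaler_sumr entropy_ortho_sum => [|f|f g fg]; first last.
- rewrite -!scalemxAl -!scalemxAr -!mulmxA (mulmxA _ (X g)) XX (negPf fg).
  by rewrite mul_scalar_mx scale0r !mulmx0 !scaler0.
- by apply: psdZ => //; exact: psd_conj.
have -> : ln q%:R / ln 2 = \sum_(f < q) (ln q%:R / ln 2) / q%:R :> R.
  by rewrite sumr_const card_ord -[RHS]mulr_natr divfK.
rewrite mulr_suml -big_split /=; apply: eq_bigr => f _.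
rewrite scalemxAl scalemxAr entropy_isometry ?XX ?eqxx //; last exact: psdZ.
by rewrite entropy_scale // mulrDl.
Qed.

End EntropyInvariance.

(** * Local operators and flattenings *)

Lemma sum_enum_val (V : zmodType) (T : finType) (F : T -> V) :
  \sum_(a < #|{: T}|) F (enum_val a) = \sum_x F x.
Proof. by rewrite -(big_enum_val F); apply: eq_bigl => x. Qed.

Section MultiIndex.
Variables (R : comNzRingType) (I : finType).
Implicit Types d e : I -> nat.

(** Dependent form of the distributivity of products over sums, which
    underlies the multiplicativity of tensor products of matrices. *)
Lemma prod_sum_multi d (F : forall i, 'I_(d i) -> R) :
  \prod_i \sum_j F i j = \sum_(f : multi_index d) \prod_i F i (f i).
Proof.
pose F' i : {ffun 'I_(d i) -> R} := finfun (F i).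
transitivity (\prod_i \sum_j F' i j).
  by apply: eq_bigr => i _; apply: eq_bigr => j _; rewrite ffunE.
under eq_bigr do rewrite (big_tag F').
rewrite bigA_distr_big_dep /= -big_fprod.
rewrite [RHS](reindex (@dffun_of_fprod I (fun i => 'I_(d i)))) /=; last first.
  exact/onW_bij/dffun_of_fprod_bij.
by apply: eq_bigr => f _; apply: eq_bigr => i _; rewrite !ffunE.
Qed.

Variable S : {set I}.

Definition res_index d (l : multi_index d) : multi_index (@leg_dim I d S) :=
  [ffun i => l (val i)].

Lemma merge_in d (a : multi_index (@leg_dim I d S)) b (i : leg S) :
  merge_index a b (val i) = a i.
Proof.
rewrite ffunE; case: i => i iS /=.
(* The goal depends on the boolean i \in S, so the match is generalized over it. *)
have gen c (x : alt_spec (i \in S) (i \in S) c) :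
    match x with
    | AltTrue h => a (exist _ i h)
    | AltFalse h => b (exist _ i (notin_setC h))
    end = a (exist _ i iS).
  by case: x => [h|h]; [rewrite (bool_irrelevance h iS) | case/negP: (h)].
exact: gen.
Qed.

Lemma merge_notin d (a : multi_index (@leg_dim I d S)) b (i : leg (~: S)) :
  merge_index a b (val i) = b i.
Proof.
rewrite ffunE; case: i => i iS /=.
have gen c (x : alt_spec (i \in S) (i \in S) c) :
    match x with
    | AltTrue h => a (exist _ i h)
    | AltFalse h => b (exist _ i (notin_setC h))
    end = b (exist _ i iS).
  case: x => [h|h]; last by rewrite (bool_irrelevance (notin_setC h) iS).
  by exfalso; move: iS; rewrite inE h.
exact: gen.
Qed.

End MultiIndex.

Section Merge.
Variables (I : finType) (S : {set I}).
Implicit Types d e : I -> nat.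

Lemma merge_indexK1 d (a : multi_index (@leg_dim I d S)) b :
  res_index S (merge_index a b) = a.
Proof. by apply/ffunP => i; rewrite ffunE merge_in. Qed.

Lemma merge_indexK2 d (a : multi_index (@leg_dim I d S)) b :
  res_index (~: S) (merge_index a b) = b.
Proof. by apply/ffunP => i; rewrite ffunE merge_notin. Qed.

Lemma res_indexK d (l : multi_index d) :
  merge_index (res_index S l) (res_index (~: S) l) = l.
Proof.
apply/ffunP => i; have [iS|iS] := boolP (i \in S).
  by have /= -> := merge_in (res_index S l) (res_index (~: S) l) (exist _ i iS); rewrite ffunE.
have iS' : i \in ~: S by rewrite inE.
by have /= -> := merge_notin (res_index S l) (res_index (~: S) l) (exist _ i iS'); rewrite ffunE.
Qed.

Lemma sum_merge (V : zmodType) d (F : multi_index d -> V) :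
  \sum_l F l = \sum_(a : multi_index (@leg_dim I d S)) \sum_b F (merge_index a b).
Proof.
rewrite pair_bigA /= (reindex (fun p : multi_index (@leg_dim I d S) *
    multi_index (@leg_dim I d (~: S)) => merge_index p.1 p.2)) //=.
exists (fun l => (res_index S l, res_index (~: S) l)) => [[a b] _|l _] /=.
  by rewrite merge_indexK1 merge_indexK2.
exact: res_indexK.
Qed.

Lemma prod_leg (R : comNzRingType) (F : I -> R) :
  \prod_(i : leg S) F (val i) = \prod_(i in S) F i.
Proof. by rewrite [RHS]big_sub. Qed.

End Merge.

Lemma prod_legs (R : comNzRingType) (I : finType) (S : {set I}) (F : I -> R) :
  \prod_i F i = (\prod_(i : leg S) F (val i)) * \prod_(i : leg (~: S)) F (val i).
Proof.
rewrite (prod_leg S F) (prod_leg (~: S) F) (bigID (mem S)) /=; congr (_ * _).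
by apply: eq_bigl => i; rewrite inE.
Qed.

Section Tact.
Variables (R : realType) (I : finType).
Local Notation C := R[i].
Implicit Types d e : I -> nat.

Definition legcoef d e (S : {set I}) (M : forall i, 'M[C]_(e i, d i))
    (a : multi_index (@leg_dim I e S)) (b : multi_index (@leg_dim I d S)) : C :=
  \prod_(i : leg S) M (val i) (a i) (b i).

(** The tensor product of the matrices M i over the legs i in S. *)
Definition legmx d e (S : {set I}) (M : forall i, 'M[C]_(e i, d i)) :
    'M[C]_(#|{: multi_index (@leg_dim I e S)}|, #|{: multi_index (@leg_dim I d S)}|) :=
  \matrix_(a, b) legcoef M (enum_val a) (enum_val b).

Lemma legmxM d e f S (M : forall i, 'M[C]_(f i, e i)) (N : forall i, 'M[C]_(e i, d i)) :
  legmx S (fun i => M i *m N i) = legmx S M *m legmx S N.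
Proof.
apply/matrixP => a b; rewrite !mxE.
rewrite /legcoef; under eq_bigr do rewrite mxE.
rewrite (prod_sum_multi (d := @leg_dim I e S)) /= -sum_enum_val.
by apply: eq_bigr => c _; rewrite !mxE -big_split.
Qed.

Lemma legmx_adj d e S (M : forall i, 'M[C]_(e i, d i)) :
  (legmx S M)^t* = legmx S (fun i => (M i)^t*).
Proof.
apply/matrixP => a b; rewrite !mxE /legcoef rmorph_prod.
by apply: eq_bigr => i _; rewrite !mxE.
Qed.

Lemma legmx1 d S : legmx S (fun i => 1%:M : 'M[C]_(d i)) = 1%:M.
Proof.
apply/matrixP => a b; rewrite !mxE /legcoef; have [<-|ab] := eqVneq a b.
  by rewrite big1 // => i _; rewrite mxE eqxx.
apply/eqP; apply: contraT => /prodf_neq0 n0; case/eqP: ab.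
apply: enum_val_inj; apply/ffunP => i; apply/eqP.
by apply: contraTT (n0 i isT) => ab; rewrite mxE (negPf ab) negbK.
Qed.

Lemma flattening_tact d e S (M : forall i, 'M[C]_(e i, d i)) (psi : tensor R d) :
  flattening S (tact M psi) =
  legmx S M *m flattening S psi *m (legmx (~: S) M)^T.
Proof.
apply/matrixP => a b; rewrite !mxE ffunE (sum_merge S) exchange_big /=.
rewrite -[LHS]sum_enum_val; apply: eq_bigr => b' _; rewrite !mxE mulr_suml.
rewrite -[LHS]sum_enum_val; apply: eq_bigr => a' _.
rewrite !mxE (prod_legs S) mulrAC /legcoef.
congr (_ * _ * _); apply: eq_bigr => i _; first by rewrite !merge_in.
by rewrite !merge_notin.
Qed.

Lemma tact_comp d e f (M : forall i, 'M[C]_(f i, e i)) (N : forall i, 'M[C]_(e i, d i))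
    (psi : tensor R d) :
  tact M (tact N psi) = tact (fun i => M i *m N i) psi.
Proof.
apply/ffunP => m; rewrite !ffunE.
under eq_bigr do rewrite ffunE mulr_sumr.
rewrite exchange_big /=; apply: eq_bigr => l _.
under [in RHS]eq_bigr do rewrite mxE.
rewrite prod_sum_multi mulr_suml; apply: eq_bigr => j _.
by rewrite mulrA -big_split.
Qed.

End Tact.

(** * Reduced densities and flagged sums *)

Section ReducedDensity.
Variables (R : realType) (I : finType).
Local Notation C := R[i].
Implicit Types (d e : I -> nat) (S : {set I}).

Lemma norm2sq_trace d S (psi : tensor R d) :
  norm2sq psi = \tr (flattening S psi *m (flattening S psi)^t*).
Proof.
rewrite /norm2sq (sum_merge S) -[LHS]sum_enum_val; apply: eq_bigr => a _.
rewrite mxE -[LHS]sum_enum_val; apply: eq_bigr => b _.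
by rewrite !mxE normCK.
Qed.

Lemma norm2sq_ge0 d (psi : tensor R d) : 0 <= norm2sq psi.
Proof. by apply: sumr_ge0 => l _; rewrite exprn_ge0. Qed.

Lemma norm2sq_eq0 d (psi : tensor R d) : (norm2sq psi == 0) = (psi == 0).
Proof.
apply/eqP/eqP => [/psumr_eq0P e|->]; last first.
  by rewrite /norm2sq big1 // => l _; rewrite ffunE normr0 expr0n.
apply/ffunP => l; rewrite ffunE; apply/eqP; rewrite -normr_eq0 -sqrf_eq0.
by rewrite e // => l' _; rewrite exprn_ge0.
Qed.

Lemma psd_reduced_density d S (psi : tensor R d) : psdmx (reduced_density S psi).
Proof. by apply: psdZ (psd_gram _); rewrite invr_ge0 norm2sq_ge0. Qed.

Lemma trace_reduced_density d S (psi : tensor R d) : psi != 0 ->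
  \tr (reduced_density S psi) = 1.
Proof.
by move=> p0; rewrite /reduced_density mxtraceZ -norm2sq_trace mulVf // norm2sq_eq0.
Qed.

(** The columns of the flattening along ~: S are indexed by the legs in
    ~: ~: S, which is not convertible to S; only the Gram matrices of the two
    flattenings can be compared without a transport. *)
Lemma flattening_gramC d S (psi : tensor R d) :
  flattening (~: S) psi *m (flattening (~: S) psi)^t* =
  (flattening S psi)^T *m ((flattening S psi)^T)^t*.
Proof.
apply/matrixP => b b'; rewrite !mxE.
under eq_bigr do rewrite !mxE.
under [RHS]eq_bigr do rewrite !mxE.
rewrite (sum_enum_val (fun a' => psi (merge_index (enum_val b) a') *
  (psi (merge_index (enum_val b') a'))^*)).
rewrite (sum_enum_val (fun a => psi (merge_index a (enum_val b)) *
  (psi (merge_index a (enum_val b')))^*)).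
have indep a c c' : res_index (~: ~: S) (merge_index a c) =
    res_index (~: ~: S) (@merge_index I d S a c').
  apply/ffunP => -[i iS]; rewrite [LHS]ffunE [RHS]ffunE /=.
  have iS' : i \in S by move: iS; rewrite !inE negbK.
  have /= -> := merge_in a c (exist _ i iS').
  by have /= -> := merge_in a c' (exist _ i iS').
have mergeC a c : merge_index c (res_index (~: ~: S) (merge_index a c)) =
    @merge_index I d S a c.
  by rewrite -[X in merge_index X _](merge_indexK2 a c) res_indexK.
rewrite (reindex (fun a => res_index (~: ~: S) (merge_index a (enum_val b)))) /=.
  apply: eq_bigr => a _; rewrite mergeC.
  by rewrite (indep _ _ (enum_val b')) mergeC.
exists (fun a' => res_index S (merge_index (enum_val b) a')) => [a _|a' _].
  by rewrite mergeC merge_indexK1.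
rewrite -[RHS](merge_indexK2 (enum_val b) a').
set l := merge_index _ a'.
have {1}-> : enum_val b = res_index (~: S) l by rewrite merge_indexK1.
by rewrite res_indexK.
Qed.

Lemma side_entropyC d S (psi : tensor R d) :
  side_entropy (~: S) psi = side_entropy S psi.
Proof.
rewrite /side_entropy /reduced_density flattening_gramC.
have N0 : 0 <= (norm2sq psi)^-1 by rewrite invr_ge0 norm2sq_ge0.
by have /esym := entropy_gram_trmx (flattening S psi) N0.
Qed.

Lemma side_entropy_le d S (psi : tensor R d) : psi != 0 ->
  side_entropy S psi <= ln #|{: multi_index (@leg_dim I d S)}|%:R / ln 2.
Proof.
move=> p0; apply: entropy_le_log; first exact: psd_reduced_density.
exact: trace_reduced_density.
Qed.

Lemma side_entropy_ge0 d S (psi : tensor R d) : psi != 0 ->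
  0 <= side_entropy S psi.
Proof.
move=> p0; apply: entropy_ge0; first exact: psd_reduced_density.
exact: trace_reduced_density.
Qed.

Lemma card_multi_index d : #|{: multi_index d}| = (\prod_i d i)%N.
Proof.
rewrite -(eq_bigr _ (fun i _ => card_ord (d i))) -card_fprod.
exact: (bij_eq_card (fprod_of_dffun_bij (fun i => 'I_(d i)))).
Qed.

End ReducedDensity.

Section Flags.
Variables (R : realType) (I : finType) (d e : I -> nat) (q : nat).
Local Notation C := R[i].
Variable flagged : {set I}.
Variable W : 'I_q -> forall i, 'M[C]_(e i, d i).
Hypothesis W_iso : forall f i, (W f i)^t* *m W f i = 1%:M.
Hypothesis W_ortho : forall f g i, f != g -> i \in flagged -> (W f i)^t* *m W g i = 0.
Hypothesis W_const : forall f g i, i \notin flagged -> W f i = W g i.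
Variable phi : 'I_q -> tensor R d.
Variable N : C.
Hypothesis phi_norm : forall f, norm2sq (phi f) = N.
Hypothesis q_gt0 : (0 < q)%N.

Let Psi : tensor R e := \sum_f tact (W f) (phi f).

Lemma legmx_iso (S : {set I}) f : (legmx S (W f))^t* *m legmx S (W f) = 1%:M.
Proof.
rewrite legmx_adj -legmxM -legmx1; apply/matrixP => a b; rewrite !mxE.
by apply: eq_bigr => i _; rewrite W_iso.
Qed.

Lemma legmx_flags (S : {set I}) f g : ~~ [disjoint S & flagged] ->
  (legmx S (W f))^t* *m legmx S (W g) = (f == g)%:R%:M.
Proof.
have [<- _|fg] := eqVneq f g; first exact: legmx_iso.
move=> /pred0Pn[i /andP[/= iS iF]]; rewrite legmx_adj -legmxM.
apply/matrixP => a b; rewrite !mxE /legcoef (bigD1 (exist _ i iS)) //=.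
by rewrite W_ortho // mxE !mul0r mul0rn.
Qed.

Lemma legmx_const (S : {set I}) f g : [disjoint S & flagged] ->
  legmx S (W f) = legmx S (W g).
Proof.
move=> /disjointFr SF; apply/matrixP => a b; rewrite !mxE.
apply: eq_bigr => -[i iS] _ /=; rewrite (W_const f g) //.
by rewrite SF.
Qed.

Lemma flattening_sum (S : {set I}) :
  flattening S Psi = \sum_f legmx S (W f) *m flattening S (phi f) *m
                            (legmx (~: S) (W f))^T.
Proof.
under [RHS]eq_bigr do rewrite -flattening_tact.
apply/matrixP => a b; rewrite mxE sum_ffunE summxE.
by apply: eq_bigr => f _; rewrite mxE.
Qed.

(** The cross terms between different branches vanish because the opposite side
    ~: S holds the flag. *)
Lemma gram_flags (S : {set I}) : ~~ [disjoint ~: S & flagged] ->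
  flattening S Psi *m (flattening S Psi)^t* =
  \sum_f legmx S (W f) *m (flattening S (phi f) *m (flattening S (phi f))^t*) *m
         (legmx S (W f))^t*.
Proof.
move=> SF; rewrite {1}flattening_sum mulmx_suml; apply: eq_bigr => f _.
have YY g : (legmx (~: S) (W f))^T *m ((legmx (~: S) (W g))^T)^t* = (f == g)%:R%:M.
  have -> : ((legmx (~: S) (W g))^T)^t* = ((legmx (~: S) (W g))^t*)^T.
    by apply/matrixP => a b; rewrite !mxE.
  by rewrite -trmx_mul legmx_flags // tr_scalar_mx eq_sym.
have -> : (flattening S Psi)^t* = \sum_g ((legmx (~: S) (W g))^T)^t* *m
    ((flattening S (phi g))^t* *m (legmx S (W g))^t*).
  rewrite flattening_sum raddf_sum raddf_sum /=.
  by apply: eq_bigr => g _; rewrite !ctmxM mulmxA.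
rewrite mulmx_sumr (bigD1 f) //= big1 => [|g gf]; last first.
  by rewrite -(mulmxA (_ *m _)) [_^T *m (_ *m _)]mulmxA YY eq_sym (negPf gf) raddf0 mul0mx mulmx0.
by rewrite addr0 -(mulmxA (_ *m _)) [_^T *m (_ *m _)]mulmxA YY eqxx mul1mx !mulmxA.
Qed.

Lemma norm2sq_flags (S : {set I}) : ~~ [disjoint ~: S & flagged] ->
  norm2sq Psi = q%:R * N.
Proof.
move=> SF; rewrite (norm2sq_trace S) gram_flags // raddf_sum /=.
rewrite (eq_bigr (fun=> N)) ?sumr_const ?card_ord ?mulr_natl // => f _.
by rewrite mxtrace_mulC (mulmxA _ (legmx S (W f))) legmx_iso mul1mx -norm2sq_trace.
Qed.

Lemma reduced_density_flags (S : {set I}) : ~~ [disjoint ~: S & flagged] ->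
  reduced_density S Psi = q%:R^-1 *: \sum_f legmx S (W f) *m
    reduced_density S (phi f) *m (legmx S (W f))^t*.
Proof.
move=> SF; rewrite /reduced_density (norm2sq_flags SF) (gram_flags SF).
rewrite invfM -scalerA; congr (_ *: _); rewrite scaler_sumr.
by apply: eq_bigr => f _; rewrite phi_norm -scalemxAr -scalemxAl.
Qed.

Lemma side_entropy_flags_cut (S : {set I}) :
  ~~ [disjoint S & flagged] -> ~~ [disjoint ~: S & flagged] ->
  (forall f, phi f != 0) ->
  side_entropy S Psi = (\sum_f side_entropy S (phi f)) / q%:R + ln q%:R / ln 2.
Proof.
move=> SF SF' p0; rewrite /side_entropy reduced_density_flags //.
rewrite entropy_flags // => [f g|f|f]; first exact: legmx_flags.
- exact: psd_reduced_density.
- exact: trace_reduced_density.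
Qed.

End Flags.

(** * Entropies after grafting one branch *)

Section Uncut.
Variables (R : realType) (I : finType) (d e : I -> nat) (q' : nat).
Local Notation C := R[i].
Local Notation q := q'.+1.

Lemma trace_mul_psd n (A B : 'M[C]_n) : psdmx A -> \tr A = 1 -> psdmx B ->
  \tr B = 1 -> \tr (A *m B) <= 1.
Proof.
move=> A0 A1 B0 B1; pose P := spectralmx B.
have PU : P \is unitarymx by exact: spectral_unitarymx.
have P1 : P^t* *m P = 1%:M.
  by rewrite -invmx_unitary // mulVmx // unitarymx_unit.
have BE : B = P^t* *m diag_mx (spectral_diag B) *m P.
  by rewrite -invmx_unitary //; exact/orthomx_spectralP/psd_normal.
rewrite {1}BE !mulmxA mxtrace_mulC !mulmxA.
have -> : 1 = \sum_j (P *m A *m P^t*) j j :> C.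
  by rewrite -[RHS]/(\tr _) mxtrace_mulC mulmxA P1 mul1mx.
apply: ler_sum => j _; rewrite mul_mx_diag mxE ler_piMr //.
  by apply: psd_diag_ge0; exact: psd_conj.
rewrite -B1 trace_spectral; last exact: psd_normal.
by rewrite (bigD1 j) //= lerDl sumr_ge0 // => i _; exact: psd_spectral_ge0.
Qed.

Variable flagged : {set I}.
Variable W : 'I_q -> forall i, 'M[C]_(e i, d i).
Hypothesis W_iso : forall f i, (W f i)^t* *m W f i = 1%:M.
Hypothesis W_ortho : forall f g i, f != g -> i \in flagged -> (W f i)^t* *m W g i = 0.
Hypothesis W_const : forall f g i, i \notin flagged -> W f i = W g i.
Variables psi graft : tensor R d.
Hypothesis psi_neq0 : psi != 0.
Hypothesis graft_norm : norm2sq graft = norm2sq psi.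
Hypothesis q'_gt0 : (0 < q')%N.

Definition branch (f : 'I_q) := if f == ord_max then graft else psi.

Definition flag_sum : tensor R e := \sum_f tact (W f) (branch f).

Lemma branch_norm f : norm2sq (branch f) = norm2sq psi.
Proof. by rewrite /branch; case: ifP. Qed.

Lemma branch_neq0 f : branch f != 0.
Proof. by rewrite -norm2sq_eq0 branch_norm norm2sq_eq0. Qed.

Lemma graft_neq0 : graft != 0.
Proof. by have := branch_neq0 ord_max; rewrite /branch eqxx. Qed.

Lemma sum_branch (V : zmodType) (F : tensor R d -> V) :
  \sum_f F (branch f) = F psi *+ q' + F graft.
Proof.
rewrite big_ord_recr /= /branch eqxx; congr (_ + _).
rewrite (eq_bigr (fun=> F psi)) ?sumr_const ?card_ord // => f _.
by rewrite -val_eqE /= ltn_eqF.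
Qed.

Lemma flag_sum_neq0 (S : {set I}) : ~~ [disjoint ~: S & flagged] -> flag_sum != 0.
Proof.
move=> SF; rewrite -norm2sq_eq0 (norm2sq_flags W_iso W_ortho branch_norm SF).
by rewrite mulf_eq0 norm2sq_eq0 negb_or psi_neq0 pnatr_eq0.
Qed.

Lemma side_entropy_cut (S : {set I}) :
  ~~ [disjoint S & flagged] -> ~~ [disjoint ~: S & flagged] ->
  (1 - q%:R^-1) * side_entropy S psi + ln q%:R / ln 2 <= side_entropy S flag_sum.
Proof.
move=> SF SF'.
rewrite (side_entropy_flags_cut W_iso W_ortho branch_norm _ SF SF') //; last exact: branch_neq0.
have qR : q%:R != 0 :> R by rewrite pnatr_eq0.
have -> : 1 - q%:R^-1 = q'%:R / q%:R :> R.
  by apply: (mulIf qR); rewrite mulrBl mul1r mulVf // divfK // -natr1 addrK.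
have j0 := side_entropy_ge0 S graft_neq0.
have -> : \sum_f side_entropy S (branch f) =
    side_entropy S psi *+ q' + side_entropy S graft := sum_branch (side_entropy S).
move: (side_entropy S psi) (side_entropy S graft) j0 => x y y0.
by rewrite lerD2r mulrAC ler_pM2r ?invr_gt0 ?ltr0n // mulr_natl lerDl.
Qed.

(** The side S holds no flag, so the isometries of all branches agree on S and
    the reduced densities of the branches are mixed there. *)
Lemma side_entropy_uncut (S : {set I}) (x : R) :
  [disjoint S & flagged] -> ~~ [disjoint ~: S & flagged] -> 0 <= x ->
  \tr (reduced_density S graft *m reduced_density S psi) <= x%:C ->
  (1 - q%:R^-1) * side_entropy S psi - q%:R^-1 * (ln (x + q%:R^-1) / ln 2)
    <= side_entropy S flag_sum.
Proof.
move=> SF SF' x0 tx; set p : R := q%:R^-1.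
have p0 : 0 < p by rewrite invr_gt0 ltr0n.
have p1 : p < 1 by rewrite invf_lt1 ?ltr0n // ltr1n ltnS.
rewrite /side_entropy (reduced_density_flags W_iso W_ortho branch_norm SF').
set rho := reduced_density S psi; set sigma := reduced_density S graft.
have r0 : psdmx rho by exact: psd_reduced_density.
have s0 : psdmx sigma by exact: psd_reduced_density.
have r1 : \tr rho = 1 by exact: trace_reduced_density.
have s1 : \tr sigma = 1 by apply: trace_reduced_density; exact: graft_neq0.
pose K := legmx S (W ord0).
have -> : q%:R^-1 *: (\sum_f legmx S (W f) *m reduced_density S (branch f) *m
    (legmx S (W f))^t*) = K *m ((1 - p)%:C *: rho + p%:C *: sigma) *m K^t*.
  have -> : \sum_f legmx S (W f) *m reduced_density S (branch f) *m
    (legmx S (W f))^t* = K *m (\sum_f reduced_density S (branch f)) *m K^t*.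
    rewrite mulmx_sumr mulmx_suml; apply: eq_bigr => f _.
    by rewrite /K (legmx_const W_const ord0 f SF).
  have -> : \sum_f reduced_density S (branch f) = rho *+ q' + sigma :=
    sum_branch (reduced_density S).
  rewrite scalemxAl scalemxAr; congr (_ *m _ *m _).
  have qC : q%:R != 0 :> C by rewrite pnatr_eq0.
  have pE : p%:C = q%:R^-1 by rewrite fmorphV rmorph_nat.
  have -> : (1 - p)%:C = q%:R^-1 * q'%:R.
    by apply: (mulfI qC); rewrite mulVKf // rmorphB /= pE mulrBr mulr1 mulfV // -natr1 addrK.
  by rewrite scalerDr pE -scalerA scaler_nat.
rewrite entropy_isometry; first last.
- by apply: psdD; apply: psdZ => //; rewrite ler0c ltW // subr_gt0.
- exact: legmx_iso.
apply: entropy_mix => //; first by rewrite ltr_wpDl.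
rewrite -/rho -/sigma.
have -> : \tr (sigma *m ((1 - p)%:C *: rho + p%:C *: sigma)) =
    (1 - p)%:C * \tr (sigma *m rho) + p%:C * \tr (sigma *m sigma).
  by rewrite mulmxDr raddfD /= -(mxtraceZ (1 - p)%:C) -(mxtraceZ p%:C) !scalemxAr.
rewrite (_ : (x + p)%:C = x%:C + p%:C); last by rewrite -rmorphD.
have t1 : \tr (sigma *m sigma) <= 1 by exact: trace_mul_psd.
apply: lerD; last by rewrite ler_piMr // ler0c ltW.
have x0' : 0 <= x%:C by rewrite ler0c.
apply: le_trans (ler_wpM2l _ tx) _; first by rewrite ler0c subr_ge0 ltW.
by rewrite ler_piMl // lecR gerBl ltW.
Qed.

End Uncut.

(** * Flags from a shared entangled pair *)

Section TactLinear.
Variables (R : realType) (I : finType).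
Local Notation C := R[i].
Implicit Types d e : I -> nat.

Lemma tactD d e (M : forall i, 'M[C]_(e i, d i)) (psi phi : tensor R d) :
  tact M (psi + phi) = tact M psi + tact M phi.
Proof.
apply/ffunP => m; rewrite !ffunE -big_split; apply: eq_bigr => l _.
by rewrite ffunE mulrDr.
Qed.

Lemma tact_sum d e (M : forall i, 'M[C]_(e i, d i)) (J : finType) (psi : J -> tensor R d) :
  tact M (\sum_j psi j) = \sum_j tact M (psi j).
Proof.
apply: (big_morph (tact M) (@tactD _ _ M)).
by apply/ffunP => m; rewrite !ffunE big1 // => l _; rewrite ffunE mulr0.
Qed.

Lemma eq_tact d e (M N : forall i, 'M[C]_(e i, d i)) (psi : tensor R d) :
  (forall i, M i = N i) -> tact M psi = tact N psi.
Proof.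
move=> MN; apply/ffunP => m; rewrite !ffunE; apply: eq_bigr => l _.
by congr (_ * _); apply: eq_bigr => i _; rewrite MN.
Qed.

Lemma prod_boolR (b : pred I) : \prod_i (b i)%:R = [forall i, b i]%:R :> C.
Proof.
have [/fintype.forallP e|] := boolP [forall i, b i]; first by rewrite big1 // => i _; rewrite e.
rewrite negb_forall => /fintype.existsP[i bi].
by rewrite (bigD1 i) //= (negPf bi) mul0r.
Qed.

Lemma prod_eqb d (m l : multi_index d) :
  \prod_i ((m i == l i)%:R : C) = (m == l)%:R.
Proof.
rewrite (prod_boolR (fun i => m i == l i)); congr ((nat_of_bool _)%:R).
by apply/fintype.forallP/eqP => [e|-> //]; apply/ffunP => i; exact/eqP.
Qed.

Lemma tact1 d (psi : tensor R d) : tact (fun i => 1%:M) psi = psi.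
Proof.
apply/ffunP => m; rewrite ffunE.
under eq_bigr do under eq_bigr do rewrite mxE.
under eq_bigr do rewrite prod_eqb.
rewrite (bigD1 m) //= eqxx mul1r big1 ?addr0 // => l lm.
by rewrite eq_sym (negPf lm) mul0r.
Qed.

Lemma tact_unit_neq0 d (M : forall i, 'M[C]_(d i)) (psi : tensor R d) :
  (forall i, M i \in unitmx) -> psi != 0 -> tact M psi != 0.
Proof.
move=> M1; apply: contraNneq => e.
have : tact (fun i => invmx (M i)) (tact M psi) = psi.
  by rewrite tact_comp -[RHS]tact1; apply: eq_tact => i; rewrite mulVmx.
rewrite e => <-; apply/eqP/ffunP => m; rewrite !ffunE big1 // => l _.
by rewrite ffunE mulr0.
Qed.

End TactLinear.

Section FlagIsometry.
Variables (R : realType) (I : finType) (d : I -> nat) (flagged : {set I}).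
Local Notation C := R[i].

(** Only the flagged legs receive n.+1 flag values; on any other leg the flag
    space is one-dimensional, so that [inord] sends every flag to its unique index. *)
Definition flag_dim n (i : I) : nat := (if i \in flagged then n else 0).+1.

Definition flag_iso n (g : nat) (i : I) : 'M[C]_(d i * flag_dim n i, d i) :=
  \matrix_(x, a) (x == mxtens_index (a, inord g))%:R.

Lemma flag_isoM n f g i : (flag_iso n f i)^t* *m flag_iso n g i =
  (inord f == inord g :> 'I_(flag_dim n i))%:R%:M.
Proof.
apply/matrixP => a b; rewrite !mxE.
rewrite (bigD1 (mxtens_index (a, inord f))) //= big1 => [|x xa]; last first.
  by rewrite !mxE (negPf xa) conjC0 mul0r.
rewrite !mxE eqxx conjC1 mul1r addr0 (can_eq (@mxtens_indexK _ _)) xpair_eqE.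
by rewrite andbC; case: (inord f == _); case: (a == b).
Qed.

Lemma flag_iso_ortho n f g i : (f <= n)%N -> (g <= n)%N -> f != g -> i \in flagged ->
  (flag_iso n f i)^t* *m flag_iso n g i = 0.
Proof.
move=> fn gn fg iF; rewrite flag_isoM (_ : _ == _ = false) ?raddf0 //.
apply: contraNF fg => /eqP /(congr1 val); rewrite /= !inordK ?iF ?ltnS //.
by move=> ->.
Qed.

Lemma flag_iso_const n f g i : i \notin flagged -> flag_iso n f i = flag_iso n g i.
Proof.
move=> iF; apply/matrixP => x a; rewrite !mxE.
congr ((_ == mxtens_index (_, _))%:R); apply: val_inj.
have : flag_dim n i = 1%N by rewrite /flag_dim (negPf iF).
rewrite /flag_dim; move: (inord f) (inord g).
by rewrite (negPf iF) => u v _; rewrite !ord1.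
Qed.

(** The GHZ state of rank n.+1 on the flagged legs, that is, an EPR pair when there
    are two of them. *)
Definition epr n : tensor R (flag_dim n) :=
  [ffun l : multi_index (flag_dim n) =>
     \sum_(g < n.+1) [forall i, l i == inord g]%:R].

Lemma epr_neq0 n : epr n != 0.
Proof.
apply/tensor_neq0P; exists [ffun=> ord0]; rewrite ffunE big_ord_recl.
rewrite (_ : [forall i, _] = true); last first.
  by apply/fintype.forallP => i; rewrite ffunE; apply/eqP/val_inj; rewrite /= inordK.
by rewrite -natr_sum -natrD add1n pnatr_eq0.
Qed.

Lemma tkron_epr n (psi : tensor R d) :
  tkron psi (epr n) = \sum_(g < n.+1) tact (flag_iso n g) psi.
Proof.
apply/ffunP => m; rewrite ffunE sum_ffunE ffunE mulr_sumr.
apply: eq_bigr => g _; rewrite ffunE.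
set l0 : multi_index d := [ffun i => (mxtens_unindex (m i)).1].
rewrite (bigD1 l0) //= [X in _ + X]big1 ?addr0 => [|l ll0]; last first.
  apply/eqP; rewrite mulf_eq0; apply/orP; left; apply: contraNT ll0.
  move=> /prodf_neq0 n0; apply/eqP/ffunP => i; rewrite ffunE.
  have := n0 i isT; rewrite mxE pnatr_eq0 eqb0 negbK => /eqP ->.
  by rewrite mxtens_indexK.
rewrite mulrC; congr (_ * _).
rewrite -(prod_boolR R (fun i => [ffun i => (mxtens_unindex (m i)).2] i == inord g)).
apply: eq_bigr => i _; rewrite mxE !ffunE; congr ((nat_of_bool _)%:R).
apply/eqP/eqP => [<-|->]; last by rewrite mxtens_indexK.
by rewrite -[X in mxtens_index X]surjective_pairing mxtens_unindexK.
Qed.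

(** The branches q' and q'.+1 of the entangled pair are both sent to the last
    flag, after applying L 0 and L 1 respectively: adding them up is what turns two
    local operators into a joint one. *)
Lemma restricts_flag_sum q' (psi graft : tensor R d) (L : 'I_2 -> forall i, 'M[C]_(d i)) :
  (forall j i, i \notin flagged -> L j i = 1%:M) ->
  graft = \sum_j tact (L j) psi ->
  restricts (flag_sum (fun f : 'I_q'.+1 => flag_iso q' f) psi graft)
            (tkron psi (epr q'.+1)).
Proof.
move=> L1 graftE.
pose Lg (g : nat) i : 'M[C]_(d i) := if (g < q')%N then 1%:M else L (inord (g - q')) i.
pose V g i := flag_iso q' (minn g q') i *m Lg g i.
pose M i := if i \in flagged then
    \sum_(g < q'.+2) V g i *m (flag_iso q'.+1 g i)^t*
  else V 0%N i *m (flag_iso q'.+1 0 i)^t*.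
have Lg1 g i : i \notin flagged -> Lg g i = 1%:M by move=> iF; rewrite /Lg L1 // if_same.
have MV (g : 'I_q'.+2) i : M i *m flag_iso q'.+1 g i = V g i.
  rewrite /M; case: ifPn => iF; last first.
    rewrite (flag_iso_const _ g 0 iF) -mulmxA flag_isoM eqxx mulmx1.
    by rewrite /V !Lg1 // (flag_iso_const _ _ (minn g q') iF).
  rewrite mulmx_suml (bigD1 g) //= big1 => [|f fg]; last first.
    by rewrite -mulmxA flag_iso_ortho ?mulmx0 // -ltnS.
  by rewrite -mulmxA flag_isoM eqxx mulmx1 addr0.
exists M; rewrite tkron_epr tact_sum.
under [RHS]eq_bigr => g _.
  rewrite tact_comp (eq_tact _ (MV g)) -[tact (V g) psi](tact_comp (flag_iso q' (minn g q')) (Lg g)).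
  over.
rewrite /flag_sum !big_ord_recr /= -addrA; congr (_ + _).
  apply: eq_bigr => g _; rewrite /branch -val_eqE /= ltn_eqF //.
  rewrite (minn_idPl (ltnW (ltn_ord g))) /Lg /=.
  rewrite (eq_tact (N := fun=> 1%:M)) ?tact1 // => i; first by rewrite ltn_ord.
rewrite /branch eqxx minnn (minn_idPr (leqnSn q')) -tactD; congr tact.
rewrite graftE !big_ord_recl big_ord0 addr0; congr (_ + _).
  by apply: eq_tact => i; rewrite /Lg ltnn subnn; congr (L _ i); apply: val_inj; rewrite /= inordK.
apply: eq_tact => i; rewrite /Lg ltnNge leqnSn /= subSnn.
by congr (L _ i); apply: val_inj; rewrite /= inordK.
Qed.

End FlagIsometry.

(** * A nearly missed direction of a two-qubit operator *)

Section SmallVector.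
Variable C : numClosedFieldType.

Definition normsq n (v : 'cV[C]_n) : C := (v^t* *m v) 0 0.

Lemma normsqE n (v : 'cV[C]_n) : normsq v = \sum_i `|v i 0| ^+ 2.
Proof. by rewrite /normsq mxE; apply: eq_bigr => i _; rewrite !mxE mulrC normCK. Qed.

Lemma normsq_ge0 n (v : 'cV[C]_n) : 0 <= normsq v.
Proof. by rewrite normsqE sumr_ge0 // => i _; rewrite exprn_ge0. Qed.

Lemma normsq_eq0 n (v : 'cV[C]_n) : (normsq v == 0) = (v == 0).
Proof.
apply/eqP/eqP => [|->]; last by rewrite /normsq mulmx0 mxE.
rewrite normsqE => /psumr_eq0P e; apply/colP => i; rewrite mxE; apply/eqP.
by rewrite -normr_eq0 -sqrf_eq0 e // => j _; rewrite exprn_ge0.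
Qed.

Lemma normsq_gt0 n (v : 'cV[C]_n) : v != 0 -> 0 < normsq v.
Proof. by move=> v0; rewrite lt_neqAle normsq_ge0 andbT eq_sym normsq_eq0. Qed.

Lemma normsqZ n (c : C) (v : 'cV[C]_n) : normsq (c *: v) = `|c| ^+ 2 * normsq v.
Proof.
rewrite !normsqE mulr_sumr; apply: eq_bigr => i _.
by rewrite mxE normrM exprMn.
Qed.

Lemma normsq_unitary n (U : 'M[C]_n) v : U^t* *m U = 1%:M -> normsq (U *m v) = normsq v.
Proof. by move=> U1; rewrite /normsq ctmxM -mulmxA (mulmxA _ U) U1 mul1mx. Qed.

Lemma normsq_conj n (v : 'cV[C]_n) : normsq (map_mx Num.conj v) = normsq v.
Proof. by rewrite !normsqE; apply: eq_bigr => i _; rewrite mxE norm_conjC. Qed.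

(** A lower bound for the singular values, passed from M^* to M: put
    x = M^* v and expand 0 <= |M M^* v - k v|^2. *)
Lemma adj_lower_bound n (M : 'M[C]_n) (k : C) : M \in unitmx -> 0 <= k ->
  (forall v : 'cV_n, k * normsq v <= normsq (M^t* *m v)) ->
  forall x : 'cV_n, k * normsq x <= normsq (M *m x).
Proof.
move=> M1 k0 Mk x.
have Ms1 : M^t* \in unitmx by rewrite map_unitmx unitmx_tr.
pose v := invmx (M^t*) *m x.
have -> : x = M^t* *m v by rewrite mulKVmx.
have sq0 := normsq_ge0 (M *m (M^t* *m v) - k *: v).
have e : normsq (M *m (M^t* *m v) - k *: v) =
    normsq (M *m (M^t* *m v)) - 2 * k * normsq (M^t* *m v) + k ^+ 2 * normsq v.
  have kr : Num.conj k = k by apply/CrealP; rewrite ger0_real.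
  rewrite /normsq; set w := M *m _.
  have -> : (w - k *: v)^t* = w^t* - k *: v^t* by rewrite linearB /= map_mxB ctmxZ kr.
  rewrite mulmxBl !mulmxBr -!scalemxAl -!scalemxAr.
  have -> : w^t* *m v = (M^t* *m v)^t* *m (M^t* *m v).
    by rewrite /w !ctmxM trmxCK !mulmxA.
  have -> : v^t* *m w = (M^t* *m v)^t* *m (M^t* *m v).
    by rewrite /w !ctmxM trmxCK !mulmxA.
  rewrite !mxE; set a := \sum_j _; set b := \sum_j _; set c := \sum_j _; ring.
rewrite e in sq0.
have h : k ^+ 2 * normsq v <= k * normsq (M^t* *m v).
  by rewrite expr2 -mulrA; apply: ler_wpM2l.
have : 0 <= normsq (M *m (M^t* *m v)) - 2 * k * normsq (M^t* *m v) + k * normsq (M^t* *m v).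
  by apply: le_trans sq0 _; rewrite lerD2l.
move=> h2; rewrite -subr_ge0; suff <- : normsq (M *m (M^t* *m v)) - 2 * k * normsq (M^t* *m v) + k * normsq (M^t* *m v) =
  normsq (M *m (M^t* *m v)) - k * normsq (M^t* *m v) by [].
ring.
Qed.

(** The invariant symplectic form of SL_2; its tensor square [symp2] is
    the invariant symmetric form of SL_2 x SL_2 on two qubits. *)
Definition symp : 'M[C]_2 := \matrix_(i, j) (if i == j then 0 else (-1) ^+ i).

Lemma ord2P (i : 'I_2) : i = ord0 \/ i = lift ord0 ord0.
Proof. by case: i => [[|[|//]] ?]; [left|right]; apply: val_inj. Qed.

Lemma sympE (A : 'M[C]_2) : exists c, A^T *m symp *m A = c *: symp.
Proof.
exists ((A^T *m symp *m A) ord0 (lift ord0 ord0)).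
apply/matrixP => i j; rewrite !mxE !big_ord_recl !big_ord0 !mxE.
rewrite !big_ord_recl !big_ord0 !mxE /=.
by case: (ord2P i) => ->; case: (ord2P j) => ->; rewrite /=; ring.
Qed.

Lemma symp_tr : symp^T = - symp.
Proof.
apply/matrixP => i j; rewrite !mxE.
by case: (ord2P i) => ->; case: (ord2P j) => -> /=; ring.
Qed.

Lemma symp_conj : map_mx Num.conj symp = symp.
Proof.
by apply/matrixP => i j; rewrite !mxE; case: ifP => _; rewrite ?conjC0 // rmorph_sign.
Qed.

Lemma symp_sqr : symp *m symp = - 1%:M.
Proof.
apply/matrixP => i j; rewrite !mxE !big_ord_recl !big_ord0 !mxE.
by case: (ord2P i) => ->; case: (ord2P j) => -> /=; ring.
Qed.

Lemma tensmx11 m n : (1%:M : 'M[C]_m) *t (1%:M : 'M[C]_n) = 1%:M.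
Proof.
apply/matrixP => i j; rewrite !mxE -natrM mulnb; congr ((nat_of_bool _)%:R).
by rewrite -xpair_eqE -!surjective_pairing (can_eq (@mxtens_unindexK _ _)).
Qed.

Lemma tensmxNN m n p q (A : 'M[C]_(m, n)) (B : 'M[C]_(p, q)) : (- A) *t (- B) = A *t B.
Proof. by apply/matrixP => i j; rewrite !mxE mulrNN. Qed.

Lemma tensmxZZ m n p q a b (A : 'M[C]_(m, n)) (B : 'M[C]_(p, q)) :
  (a *: A) *t (b *: B) = (a * b) *: (A *t B).
Proof. by apply/matrixP => i j; rewrite !mxE mulrACA. Qed.

Definition symp2 : 'M[C]_(2 * 2) := symp *t symp.

Lemma symp2_tr : symp2^T = symp2.
Proof. by rewrite trmx_tens symp_tr tensmxNN. Qed.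

Lemma symp2_conj : map_mx Num.conj symp2 = symp2.
Proof. by rewrite map_mxT symp_conj. Qed.

Lemma symp2_sqr : symp2 *m symp2 = 1%:M.
Proof. by rewrite tensmx_mul symp_sqr tensmxNN tensmx11. Qed.

Lemma symp2_unitary : symp2^t* *m symp2 = 1%:M.
Proof. by rewrite symp2_tr symp2_conj symp2_sqr. Qed.

Lemma symp2E (A B : 'M[C]_2) : exists c,
  (A *t B)^T *m symp2 *m (A *t B) = c *: symp2.
Proof.
have [a ea] := sympE A; have [b eb] := sympE B; exists (a * b).
by rewrite trmx_tens !tensmx_mul ea eb tensmxZZ.
Qed.

Definition frobsq m n (M : 'M[C]_(m, n)) : C := \tr (M *m M^t*).

Lemma frobsqE m n (M : 'M[C]_(m, n)) : frobsq M = \sum_i \sum_j `|M i j| ^+ 2.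
Proof.
apply: eq_bigr => i _; rewrite mxE; apply: eq_bigr => j _.
by rewrite !mxE normCK.
Qed.

Lemma frobsq_ge0 m n (M : 'M[C]_(m, n)) : 0 <= frobsq M.
Proof. by rewrite frobsqE; do 2!apply: sumr_ge0 => ? _; rewrite exprn_ge0. Qed.

Lemma frobsq_gt0 n (M : 'M[C]_n.+1) : M \in unitmx -> 0 < frobsq M.
Proof.
move=> M1; rewrite lt_neqAle frobsq_ge0 andbT eq_sym.
apply: contraTneq M1; rewrite frobsqE => /psumr_eq0P e.
suff -> : M = 0 by rewrite unitr0.
apply/matrixP => i j; rewrite mxE; apply/eqP; rewrite -normr_eq0 -sqrf_eq0.
have /psumr_eq0P -> // : \sum_j `|M i j| ^+ 2 = 0.
  by apply: e => // k _; apply: sumr_ge0 => ? _; rewrite exprn_ge0.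
Qed.

Lemma frobsq_trmx m n (M : 'M[C]_(m, n)) : frobsq M^T = frobsq M.
Proof.
rewrite !frobsqE exchange_big /=; apply: eq_bigr => i _; apply: eq_bigr => j _.
by rewrite mxE.
Qed.

Lemma frobsq_symp2 (M : 'M[C]_(2 * 2)) : frobsq (symp2 *m M *m symp2) = frobsq M.
Proof.
rewrite /frobsq !ctmxM symp2_tr symp2_conj !mulmxA -(mulmxA _ symp2 symp2).
rewrite symp2_sqr mulmx1 -!mulmxA mxtrace_mulC.
by rewrite -!mulmxA symp2_sqr mulmx1.
Qed.

Lemma norm_trace_mul n (M N : 'M[C]_n) : `|\tr (M *m N)| *+ 2 <= frobsq M + frobsq N.
Proof.
have -> : frobsq M + frobsq N = \sum_i \sum_j (`|M i j| ^+ 2 + `|N j i| ^+ 2).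
  rewrite -(frobsq_trmx N) !frobsqE -big_split; apply: eq_bigr => i _.
  by rewrite -big_split; apply: eq_bigr => j _; rewrite !mxE.
apply: (@le_trans _ _ (\sum_i \sum_j (`|M i j| * `|N j i| *+ 2))).
  under eq_bigr do rewrite sumrMnl.
  rewrite sumrMnl lerMn2r /=; apply: le_trans (ler_norm_sum _ _ _) _.
  apply: ler_sum => i _; rewrite mxE; apply: le_trans (ler_norm_sum _ _ _) _.
  by apply: ler_sum => j _; rewrite normrM.
apply: ler_sum => i _; apply: ler_sum => j _.
rewrite -subr_ge0; have : 0 <= (`|M i j| - `|N j i|) ^+ 2.
  by rewrite real_exprn_even_ge0 // rpredB // normr_real.
by rewrite sqrrB addrAC.
Qed.

(** Two-qubit index with both bits 1; [idx00] below is its complement, with which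
    [symp2] pairs it. *)
Definition idx11 : 'I_(2 * 2) := mxtens_index (lift ord0 ord0, lift ord0 ord0).
Definition idx00 : 'I_(2 * 2) := mxtens_index (ord0, ord0).

Definition weights (dl : C) : 'rV[C]_(2 * 2) := \row_s (if s == idx11 then dl else 1).

Lemma delta_tensmx m n (i k : 'I_m) (j l : 'I_n) :
  delta_mx i k *t delta_mx j l =
  delta_mx (mxtens_index (i, j)) (mxtens_index (k, l)) :> 'M[C]_(_, _).
Proof.
apply/matrixP => x y; case: (mxtens_indexP x) => x1 x2; case: (mxtens_indexP y) => y1 y2.
rewrite !mxE !mxtens_indexK /= !(can_eq (@mxtens_indexK _ _)) !xpair_eqE.
by rewrite -natrM mulnb andbACA.
Qed.

Lemma symp_delta : symp *m delta_mx (lift ord0 ord0) (lift ord0 ord0) *m symp =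
  - delta_mx ord0 ord0.
Proof.
apply/matrixP => i j; rewrite !mxE !big_ord_recl !big_ord0 !mxE.
rewrite !big_ord_recl !big_ord0 !mxE /=.
by case: (ord2P i) => ->; case: (ord2P j) => -> /=; ring.
Qed.

Lemma symp2_delta : symp2 *m delta_mx idx11 idx11 *m symp2 = delta_mx idx00 idx00.
Proof.
by rewrite -!delta_tensmx !tensmx_mul symp_delta tensmxNN.
Qed.

Lemma idx00_neq_idx11 : idx00 != idx11.
Proof. by []. Qed.

Lemma diag_weights dl : diag_mx (weights dl) = 1%:M - (1 - dl) *: delta_mx idx11 idx11.
Proof.
apply/matrixP => i j; rewrite !mxE; have [<-|ij] := eqVneq i j.
  by case: eqP => _ /=; rewrite ?mulr1n ?mulr0n; ring.
rewrite mulr0n (_ : _ && _ = false) ?mulr0 ?subr0 //.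
by apply: contraNF ij => /andP[/eqP -> /eqP ->].
Qed.

(** The matrix is diagonal: the weight of each index is multiplied by that of the
    complementary index, so dl appears at both idx00 and idx11. *)
Lemma weights_symp2 dl :
  diag_mx (weights dl) *m symp2 *m diag_mx (weights dl) *m symp2 =
  1%:M - (1 - dl) *: (delta_mx idx11 idx11 + delta_mx idx00 idx00).
Proof.
have -> : diag_mx (weights dl) *m symp2 *m diag_mx (weights dl) *m symp2 =
   diag_mx (weights dl) *m (symp2 *m diag_mx (weights dl) *m symp2) by rewrite !mulmxA.
have -> : symp2 *m diag_mx (weights dl) *m symp2 = 1%:M - (1 - dl) *: delta_mx idx00 idx00.
  rewrite diag_weights mulmxBr mulmxBl mulmx1 symp2_sqr -scalemxAr -scalemxAl.
  by rewrite symp2_delta.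
rewrite diag_weights mulmxBr mulmx1 mulmxBl mul1mx -scalemxAl -scalemxAr.
rewrite mul_delta_mx_0 1?eq_sym // !scaler0 subr0.
by rewrite scalerDr opprD addrA.
Qed.

Lemma mxtrace_delta n (i : 'I_n) : \tr (delta_mx i i : 'M[C]_n) = 1.
Proof.
rewrite /mxtrace (bigD1 i) //= big1 ?addr0 => [|j ji]; first by rewrite mxE eqxx.
by rewrite mxE (negPf ji).
Qed.

(** Write M = B D A^T with A = A1 (x) A2, B = A3 (x) A4 and D the weights, and let
    J be the invariant form [symp2].  Since A^T J A and B^T J B are multiples a J
    and b J of J, the matrix M J M^T J is conjugate by B to a b (D J)^2.  Its trace
    is 2 a b (1 + dl), so 2 |a b| <= |M|^2, while one of its eigenvalues is a b dl.
    If M^* were bounded below by k = dl |M|^2, then so would be M and M^T, whence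
    |a b| dl >= dl |M|^2, a contradiction. *)
Lemma small_vector (A1 A2 A3 A4 : 'M[C]_2) dl :
  A1 \in unitmx -> A2 \in unitmx -> A3 \in unitmx -> A4 \in unitmx -> 0 < dl ->
  let M := (A3 *t A4) *m diag_mx (weights dl) *m (A1 *t A2)^T in
  exists2 z : 'cV_(2 * 2), z != 0 & normsq (M^t* *m z) <= dl * frobsq M * normsq z.
Proof.
move=> A1u A2u A3u A4u dl0; pose B := A3 *t A4; pose A := A1 *t A2.
rewrite -/A -/B => M; apply: contrapT => none.
have Bu : B \in unitmx by exact: tensmx_unit.
have Au : A \in unitmx by exact: tensmx_unit.
have Du : diag_mx (weights dl) \in unitmx.
  rewrite unitmxE det_diag unitfE; apply/prodf_neq0 => i _; rewrite mxE.
  by case: ifP => _; rewrite ?oner_neq0 // gt_eqF.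
have Mu : M \in unitmx by rewrite !unitmx_mul Bu Du unitmx_tr.
have fM : 0 < frobsq M by exact: frobsq_gt0.
pose k := dl * frobsq M; have k0 : 0 < k by rewrite mulr_gt0.
have lower v : k * normsq v <= normsq (M^t* *m v).
  have [->|v0] := eqVneq v 0; first by rewrite /normsq !mulmx0 mxE mulr0.
  rewrite real_leNgt ?ger0_real ?normsq_ge0 ?mulr_ge0 ?normsq_ge0 ?ltW //.
  by apply/negP => /ltW h; apply: none; exists v.
have lowerM := adj_lower_bound Mu (ltW k0) lower.
have lowerT v : k * normsq v <= normsq (M^T *m v).
  rewrite -normsq_conj -(normsq_conj (M^T *m v)) map_mxM.
  by rewrite -(map_trmx _ M) map_trmx; exact: lower.
have [a aE] := symp2E A1 A2; have [b bE] := symp2E A3 A4.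
rewrite -/A in aE; rewrite -/B in bE.
have key : M *m symp2 *m M^T *m symp2 *m B =
    (a * b) *: (B *m (1%:M - (1 - dl) *: (delta_mx idx11 idx11 + delta_mx idx00 idx00))).
  rewrite -weights_symp2 /M !trmx_mul trmxK tr_diag_mx.
  set D := diag_mx _.
  transitivity (B *m D *m (A^T *m symp2 *m A) *m D *m (B^T *m symp2 *m B)).
    by rewrite !mulmxA.
  by rewrite aE bE -!(scalemxAl, scalemxAr) scalerA mulrC !mulmxA.
have trace_le : `|a * b| *+ 2 <= frobsq M.
  have := norm_trace_mul M (symp2 *m M^T *m symp2).
  rewrite frobsq_symp2 frobsq_trmx !mulmxA -mulr2n lerMn2r /=.
  have -> : M *m symp2 *m M^T *m symp2 = (M *m symp2 *m M^T *m symp2 *m B) *m invmx B.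
    by rewrite mulmxK.
  rewrite key -scalemxAl mxtraceZ mxtrace_mulC mulKmx //.
  rewrite raddfB /= mxtrace1 mxtraceZ raddfD /= !mxtrace_delta.
  have -> : (2 * 2)%:R - (1 - dl) * (1 + 1) = 2 + dl *+ 2 by ring.
  rewrite normrM => h; apply: le_trans h; rewrite -[X in X <= _]mulr_natr ler_wpM2l //.
  have d2 : 0 <= dl *+ 2 by rewrite mulrn_wge0 // ltW.
  by rewrite ger0_norm; [rewrite lerDl | rewrite addr_ge0].
(* Eigenvector of M J M^T J for the eigenvalue a b dl. *)
pose x := B *m delta_mx idx00 (0 : 'I_1).
have x0 : x != 0.
  apply/eqP => /(congr1 (mulmx (invmx B))); rewrite mulKmx // mulmx0.
  by move=> /matrixP/(_ idx00 0); rewrite !mxE !eqxx => /eqP; rewrite oner_eq0.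
have xE : M *m (symp2 *m (M^T *m (symp2 *m x))) = (a * b * dl) *: x.
  rewrite !mulmxA key -scalemxAl -scalerA; congr (_ *: _).
  rewrite -mulmxA mulmxBl mul1mx -scalemxAl mulmxDl !mul_delta_mx_cond eqxx.
  rewrite eq_sym (negPf idx00_neq_idx11) mulr0n add0r mulr1n -[X in X - _]scale1r -scalerBl.
  by rewrite subKr -scalemxAr.
have : k * (k * normsq x) <= normsq ((a * b * dl) *: x).
  rewrite -xE; apply: le_trans (lowerM _); rewrite ler_pM2l //.
  rewrite normsq_unitary ?symp2_unitary //; apply: le_trans (lowerT _).
  by rewrite normsq_unitary ?symp2_unitary.
rewrite normsqZ mulrA ler_pM2r ?normsq_gt0 // -expr2 ler_sqr ?nnegrE ?normr_ge0 ?(ltW k0) //.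
rewrite normrM (gtr0_norm dl0) [_ * dl]mulrC /k ler_pM2l // => h.
have := le_trans trace_le h; rewrite mulr2n gerDl normr_le0 => /eqP ab0.
by move: h; rewrite ab0 normr0 => /(lt_le_trans fM); rewrite ltxx.
Qed.

End SmallVector.

(** * Two crossed pairs and the vector to graft *)

Local Opaque mxtens_unindex.

Section GramTransfer.
Variables (C : numClosedFieldType) (m p n : nat).
Variables (X : 'M[C]_(m, n)) (Y : 'M[C]_(p, n)) (B B' D : 'M[C]_n) (k k' : C).
Hypothesis GX : X^t* *m X = k *: (B^t* *m B).
Hypothesis GY : Y^t* *m Y = k' *: (B'^t* *m B').

Lemma normsq_gram y : normsq (X *m y) = k * normsq (B *m y).
Proof.
rewrite /normsq !ctmxM -!mulmxA (mulmxA _ X) GX -scalemxAl -scalemxAr mxE.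
by rewrite !mulmxA.
Qed.

Lemma gram_trmx : Y^T *m (Y^T)^t* = k' *: (B'^T *m (B'^T)^t*).
Proof.
have tr_ctmx q r (Z : 'M[C]_(q, r)) : Z^T *m (Z^T)^t* = (Z^t* *m Z)^T.
  by rewrite trmx_mul map_trmx trmxK.
by rewrite !tr_ctmx GY linearZ.
Qed.

Lemma frobsq_gram : frobsq (X *m D *m Y^T) = k * k' * frobsq (B *m D *m B'^T).
Proof.
rewrite /frobsq.
have -> : X *m D *m Y^T *m (X *m D *m Y^T)^t* =
    X *m (D *m (Y^T *m (Y^T)^t*) *m D^t* *m X^t*) by rewrite !ctmxM !mulmxA.
rewrite mxtrace_mulC -(mulmxA _ (X^t*) X) GX gram_trmx.
rewrite -!(scalemxAl, scalemxAr) !mxtraceZ mulrA; congr (_ * _).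
by rewrite mulmxA mxtrace_mulC !ctmxM !mulmxA.
Qed.

Lemma normsq_adj_gram y :
  normsq ((X *m D *m Y^T)^t* *m (X *m y)) =
  `|k| ^+ 2 * k' * normsq ((B *m D *m B'^T)^t* *m (B *m y)).
Proof.
have -> : (X *m D *m Y^T)^t* *m (X *m y) = (Y^T)^t* *m (D^t* *m ((X^t* *m X) *m y)).
  by rewrite !ctmxM !mulmxA.
have -> : (B *m D *m B'^T)^t* *m (B *m y) = (B'^T)^t* *m (D^t* *m ((B^t* *m B) *m y)).
  by rewrite !ctmxM !mulmxA.
rewrite GX -!(scalemxAl, scalemxAr) normsqZ -mulrA; congr (_ * _).
move: (D^t* *m _) => u; rewrite /normsq !ctmxM !trmxCK -!mulmxA.
rewrite (mulmxA (Y^T)) gram_trmx -scalemxAl -scalemxAr mxE.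
by rewrite !mulmxA.
Qed.

End GramTransfer.

Section Crossed.
Variables (R : realType) (I : finType).
Local Notation C := R[i].
Variables i1 i2 i3 i4 : I.

(** The four basis vectors whose sum is the product of the EPR pairs i1-i3 and
    i2-i4, with every other leg in the state 0. *)
Definition code (s : 'I_(2 * 2)) : multi_index (fun _ : I => 2%N) :=
  [ffun i => if (i == i1) || (i == i3) then (mxtens_unindex s).1
             else if (i == i2) || (i == i4) then (mxtens_unindex s).2 else ord0].

Definition crossed (dl : C) : tensor R (fun _ : I => 2%N) :=
  [ffun l : multi_index (fun _ : I => 2%N) => \sum_s weights dl 0 s * (l == code s)%:R].

Lemma tact_crossed e (M : forall i, 'M[C]_(e i, 2)) dl (m : multi_index e) :
  tact M (crossed dl) m = \sum_s weights dl 0 s * \prod_i M i (m i) (code s i).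
Proof.
rewrite ffunE; under eq_bigr do rewrite ffunE mulr_sumr.
rewrite exchange_big /=; apply: eq_bigr => s _.
rewrite (bigD1 (code s)) //= [X in _ + X]big1 ?addr0 => [|l ls].
  by rewrite eqxx mulr1 mulrC.
by rewrite (negPf ls) !mulr0.
Qed.

Definition legcol e (T : {set I}) (M : forall i, 'M[C]_(e i, 2))
    (a : multi_index (@leg_dim I e T)) (s : 'I_(2 * 2)) : C :=
  \prod_(i : leg T) M (val i) (a i) (code s (val i)).

Definition colmx e (T : {set I}) (M : forall i, 'M[C]_(e i, 2)) :
    'M[C]_(#|{: multi_index (@leg_dim I e T)}|, 2 * 2) :=
  \matrix_(a, s) legcol M (enum_val a) s.

Lemma flattening_crossed e T (M : forall i, 'M[C]_(e i, 2)) dl :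
  flattening T (tact M (crossed dl)) =
  colmx T M *m diag_mx (weights dl) *m (colmx (~: T) M)^T.
Proof.
apply/matrixP => a b; rewrite mul_mx_diag !mxE tact_crossed.
apply: eq_bigr => s _; rewrite !mxE (prod_legs T) mulrCA mulrA /legcol.
congr (_ * _ * _); first by apply: eq_bigr => i _; rewrite merge_in.
by apply: eq_bigr => i _; rewrite merge_notin.
Qed.

Lemma gram_colmx e T (M N : forall i, 'M[C]_(e i, 2)) s s' :
  ((colmx T M)^t* *m colmx T N) s s' =
  \prod_(i in T) ((M i)^t* *m N i) (code s i) (code s' i).
Proof.
rewrite -(prod_leg T (fun i => ((M i)^t* *m N i) (code s i) (code s' i))).
under [RHS]eq_bigr do rewrite mxE.
rewrite (prod_sum_multi (d := @leg_dim I e T)) -[RHS]sum_enum_val mxE.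
apply: eq_bigr => a _; rewrite !mxE /legcol rmorph_prod -big_split.
by apply: eq_bigr => i _; rewrite !mxE.
Qed.

(** The legs outside the two chosen ones carry a fixed product vector, which only
    contributes this scalar to the Gram matrix of the columns. *)
Definition dummy_norm (T : {set I}) (A : I -> 'M[C]_2) j1 j2 : C :=
  \prod_(i in T | (i != j1) && (i != j2)) ((A i)^t* *m A i) ord0 ord0.

Lemma gram_colmx_tens (T : {set I}) (A : I -> 'M[C]_2) j1 j2 : j1 \in T -> j2 \in T -> j1 != j2 ->
  (forall s, code s j1 = (mxtens_unindex s).1) ->
  (forall s, code s j2 = (mxtens_unindex s).2) ->
  (forall s i, i \in T -> i != j1 -> i != j2 -> code s i = ord0) ->
  (colmx T A)^t* *m colmx T A =
  dummy_norm T A j1 j2 *: ((A j1 *t A j2)^t* *m (A j1 *t A j2)).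
Proof.
move=> T1 T2 j12 c1 c2 c0; apply/matrixP => s s'; rewrite gram_colmx.
rewrite (bigD1 j1) //= (bigD1 j2) ?T2 1?eq_sym //= [RHS]mxE mulrA [LHS]mulrC; congr (_ * _).
  rewrite /dummy_norm; apply: eq_big => i; first by rewrite andbA.
  by move=> /andP[/andP[iT i1'] i2']; rewrite !c0.
by rewrite trmx_tens map_mxT tensmx_mul !c1 !c2 [RHS]mxE.
Qed.

Hypothesis i12 : i1 != i2.
Hypothesis i34 : i3 != i4.
Variable T : {set I}.
Hypothesis T1 : i1 \notin T.
Hypothesis T2 : i2 \notin T.
Hypothesis T3 : i3 \in T.
Hypothesis T4 : i4 \in T.

Let ne i j : i \in T -> j \notin T -> (i == j) = false.
Proof. by move=> iT; apply: contraNF => /eqP <-. Qed.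

Let notC i : i \notin T -> i \in ~: T.
Proof. by rewrite inE. Qed.

Lemma gram_inside (A : I -> 'M[C]_2) :
  (colmx T A)^t* *m colmx T A =
  dummy_norm T A i3 i4 *: ((A i3 *t A i4)^t* *m (A i3 *t A i4)).
Proof.
apply: gram_colmx_tens => // [s|s|s i iT i3' i4']; rewrite ffunE.
- by rewrite eqxx orbT.
- by rewrite eqxx orbT (ne T4 T1) eq_sym (negPf i34).
- by rewrite (ne iT T1) (ne iT T2) (negPf i3') (negPf i4').
Qed.

Lemma gram_outside (A : I -> 'M[C]_2) :
  (colmx (~: T) A)^t* *m colmx (~: T) A =
  dummy_norm (~: T) A i1 i2 *: ((A i1 *t A i2)^t* *m (A i1 *t A i2)).
Proof.
apply: gram_colmx_tens => [| | |s|s|s i iT i1' i2'].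
- exact: notC.
- exact: notC.
- exact: i12.
- by rewrite ffunE eqxx.
- by rewrite ffunE eqxx eq_sym (negPf i12) [i2 == i3]eq_sym (ne T3 T2).
- rewrite ffunE; rewrite inE in iT; rewrite (negPf i1') (negPf i2').
  by rewrite ![i == _]eq_sym (ne T3 iT) (ne T4 iT).
Qed.

(** The sum over j of the tensor products of these operators on i1 and i2 first
    undoes A there, then maps the two qubits to |00> with amplitudes given by w: a
    functional on two qubits is a sum of two products. *)
Definition bell_filter (A : I -> 'M[C]_2) (w : 'cV[C]_(2 * 2)) (j : 'I_2) (i : I) :
    'M[C]_2 :=
  if i == i1 then delta_mx ord0 j *m invmx (A i1)
  else if i == i2 then
    (\matrix_(x, y) ((x == ord0)%:R * w (mxtens_index (j, y)) 0)) *m invmx (A i2)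
  else 1%:M.

Lemma bell_filter1 A w j i : i \notin [set i1; i2] -> bell_filter A w j i = 1%:M.
Proof. by rewrite !inE negb_or /bell_filter => /andP[/negPf -> /negPf ->]. Qed.

(** What is left on the legs outside T: |0> at i1 and i2, and the vector that A
    produces from |0> elsewhere. *)
Definition graft_side (A : I -> 'M[C]_2) := fun i =>
  if i \in [set i1; i2] then 1%:M else A i.

Lemma flattening_filter (A : I -> 'M[C]_2) w dl : (forall i, A i \in unitmx) ->
  flattening T (\sum_j tact (bell_filter A w j) (tact A (crossed dl))) =
  colmx T A *m diag_mx (weights dl) *m w *m (col idx00 (colmx (~: T) (graft_side A)))^T.
Proof.
move=> Au.
have -> : flattening T (\sum_j tact (bell_filter A w j) (tact A (crossed dl))) =
    \sum_j flattening T (tact (fun i => bell_filter A w j i *m A i) (crossed dl)).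
  apply/matrixP => a b; rewrite mxE sum_ffunE summxE.
  by apply: eq_bigr => j _; rewrite tact_comp mxE.
have eT j : colmx T (fun i => bell_filter A w j i *m A i) = colmx T A.
  apply/matrixP => a s; rewrite !mxE /legcol; apply: eq_bigr => -[i iT] _ /=.
  by rewrite bell_filter1 ?mul1mx // !inE (ne iT T1) (ne iT T2).
under eq_bigr do rewrite flattening_crossed eT.
rewrite -mulmx_sumr -raddf_sum -[RHS]mulmxA; congr (_ *m _).
rewrite -[RHS]trmxK trmx_mul trmxK; congr (_^T).
apply/matrixP => a s; rewrite summxE mxE big_ord1 ![in RHS]mxE.
have [T1' T2'] := (notC T1, notC T2).
pose l1 : leg (~: T) := exist _ i1 T1'; pose l2 : leg (~: T) := exist _ i2 T2'.
have l21 : l2 != l1 by rewrite -val_eqE /= eq_sym.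
pose x : multi_index (@leg_dim I (fun=> 2%N) (~: T)) := enum_val a.
pose rest := \prod_(i : leg (~: T) | (i != l1) && (i != l2))
   A (val i) (x i) ord0.
have code0 s' i : i \in ~: T -> i != i1 -> i != i2 -> code s' i = ord0.
  rewrite inE ffunE => iT /negPf -> /negPf ->.
  by rewrite ![i == _]eq_sym (ne T3 iT) (ne T4 iT).
have c1 s' : code s' i1 = (mxtens_unindex s').1 by rewrite ffunE eqxx.
have c2 s' : code s' i2 = (mxtens_unindex s').2.
  by rewrite ffunE eqxx eq_sym (negPf i12) [i2 == i3]eq_sym (ne T3 T2).
have botE : mxtens_unindex idx00 = (ord0, ord0) by rewrite mxtens_indexK.
have -> : legcol (graft_side A) x idx00 =
    (x l1 == ord0)%:R * ((x l2 == ord0)%:R * rest).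
  rewrite /legcol (bigD1 l1) //= (bigD1 l2) //= c1 c2 botE /graft_side !inE !eqxx orbT !mxE.
  congr (_ * (_ * _)); apply: eq_bigr => -[i iT] /andP[i1' i2'] /=.
  rewrite -!val_eqE /= in i1' i2'.
  by rewrite !inE (negPf i1') (negPf i2') code0.
rewrite (eq_bigr (fun j : 'I_2 => ((mxtens_unindex s).1 == j)%:R *
  ((x l1 == ord0)%:R * ((x l2 == ord0)%:R * rest) * w (mxtens_index (j, (mxtens_unindex s).2)) 0))).
  rewrite (bigD1 (mxtens_unindex s).1) //= eqxx mul1r big1 ?addr0 => [|j js].
    by rewrite -surjective_pairing mxtens_unindexK mulrC.
  by rewrite eq_sym (negPf js) mul0r.
move=> j _; rewrite mxE -/x /legcol (bigD1 l1) //= (bigD1 l2) //= c1 c2.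
rewrite /bell_filter eqxx eq_sym (negPf i12) eqxx !mulmxKV // !mxE.
have -> : \prod_(i : leg (~: T) | (i != l1) && (i != l2))
   ((if val i == i1 then delta_mx ord0 j *m invmx (A i1)
  else if val i == i2 then
    (\matrix_(x, y) ((x == ord0)%:R * w (mxtens_index (j, y)) 0)) *m invmx (A i2)
  else 1%:M) *m A (val i)) (x i) (code s (val i)) = rest.
  apply: eq_bigr => -[i iT] /andP[i1' i2'] /=.
  rewrite -!val_eqE /= in i1' i2'.
  by rewrite (negPf i1') (negPf i2') mul1mx code0.
rewrite -mulnb natrM; ring.
Qed.

Lemma crossed_neq0 dl : crossed dl != 0.
Proof.
apply/tensor_neq0P; exists (code idx00); rewrite ffunE (bigD1 idx00) //= big1 ?addr0.
  by rewrite mxE eqxx mulr1 oner_neq0.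
move=> s sb; rewrite (_ : _ == _ = false) ?mulr0 //.
apply: contraNF sb => /eqP e.
rewrite -(mxtens_unindexK s) -(mxtens_unindexK idx00) (can_eq (@mxtens_indexK _ _)).
rewrite -pair_eqE /=; apply/andP; split.
  have := congr1 (fun f : multi_index _ => f i1) e.
  by rewrite !ffunE eqxx /= => ->.
have := congr1 (fun f : multi_index _ => f i2) e.
by rewrite !ffunE eqxx eq_sym (negPf i12) [i2 == i3]eq_sym (ne T3 T2) /= => ->.
Qed.

(** With X the columns of A on T, z given by [small_vector] and B y = z, the graft
    is built so that its reduced density on T is the projection on X y; the two
    Gram identities reduce the overlap to the one bounded in [small_vector]. *)
Lemma graft_exists (A : I -> 'M[C]_2) (dl : R) (psi := tact A (crossed dl%:C)) :
  (forall i, A i \in unitmx) -> 0 < dl ->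
  exists L : 'I_2 -> I -> 'M[C]_2,
    let graft := \sum_j tact (L j) psi in
    [/\ forall j i, i \notin [set i1; i2] -> L j i = 1%:M,
        norm2sq graft = norm2sq psi &
        \tr (reduced_density T graft *m reduced_density T psi) <= dl%:C].
Proof.
move=> Au dl0.
have psi0 : psi != 0 by apply: tact_unit_neq0 => //; exact: crossed_neq0.
have dC : 0 < dl%:C by rewrite -[0]/(0%:C) ltcR.
have [z z0 zP] := small_vector (Au i1) (Au i2) (Au i3) (Au i4) dC.
set B := A i3 *t A i4 in zP; set B' := A i1 *t A i2 in zP.
set D := diag_mx (weights dl%:C) in zP.
set M := B *m D *m B'^T in zP.
have Bu : B \in unitmx by exact: tensmx_unit.
pose X := colmx T A; pose X' := colmx (~: T) A.
pose k := dummy_norm T A i3 i4; pose k' := dummy_norm (~: T) A i1 i2.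
have GX : X^t* *m X = k *: (B^t* *m B) by exact: gram_inside.
have GX' : X'^t* *m X' = k' *: (B'^t* *m B') by exact: gram_outside.
have Du : D \in unitmx.
  rewrite unitmxE det_diag unitfE; apply/prodf_neq0 => s _; rewrite mxE.
  by case: ifP => _; rewrite ?oner_neq0 // gt_eqF.
have FE : flattening T psi = X *m D *m X'^T by exact: flattening_crossed.
have NE : norm2sq psi = k * k' * frobsq M.
  by rewrite (norm2sq_trace T) FE -[\tr _]/(frobsq _) (frobsq_gram D GX GX').
have kk : k * k' != 0.
  by apply: contraNneq psi0 => kk; rewrite -norm2sq_eq0 NE kk mul0r.
have fM0 : frobsq M != 0.
  by apply: contraNneq psi0 => f0; rewrite -norm2sq_eq0 NE f0 mulr0.
have sz0 : 0 < normsq z by exact: normsq_gt0.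
(* X and B have proportional Gram matrices, so X y plays on T the role of z = B y. *)
pose y := invmx B *m z; have By : B *m y = z := mulKVmx Bu z.
have Fv : normsq ((flattening T psi)^t* *m (X *m y)) = k ^+ 2 * k' * normsq (M^t* *m z).
  rewrite FE (normsq_adj_gram D GX GX') By; congr (_ ^+ 2 * _ * _).
  rewrite ger0_norm //; apply: prodr_ge0 => i _.
  suff -> : ((A i)^t* *m A i) ord0 ord0 = normsq (col ord0 (A i)) by exact: normsq_ge0.
  by rewrite /normsq !mxE; apply: eq_bigr => a _; rewrite !mxE.
(* The scalar c gives the graft the norm of psi. *)
pose c := sqrtC (frobsq M / normsq z).
have c2 : `|c| ^+ 2 = frobsq M / normsq z.
  have q0 : 0 <= frobsq M / normsq z by rewrite divr_ge0 ?frobsq_ge0 ?ltW.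
  by rewrite ger0_norm ?sqrtC_ge0 // sqrtCK.
pose w := c *: (invmx D *m y).
(* The weights D are inverted in w, so that the filter produces c X y. *)
exists (bell_filter A w) => graft.
pose xi := col idx00 (colmx (~: T) (graft_side A)).
have xiE : normsq xi = k'.
  have -> : normsq xi = ((colmx (~: T) (graft_side A))^t* *m colmx (~: T) (graft_side A)) idx00 idx00.
    by rewrite /normsq !mxE; apply: eq_bigr => a _; rewrite !mxE.
  have js i : i \in [set i1; i2] -> graft_side A i = 1%:M by rewrite /graft_side => ->.
  rewrite gram_outside (js i1) ?(js i2) ?inE ?eqxx ?orbT // tensmx11 trmx1 map_mx1 mulmx1.
  rewrite !mxE eqxx mulr1; apply: eq_bigr => i /andP[_ /andP[i1' i2']].
  have -> // : graft_side A i = A i.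
  by rewrite /graft_side !inE (negPf i1') (negPf i2').
have FJ : flattening T graft = c *: (X *m y) *m xi^T.
  rewrite (flattening_filter w _ Au) -/xi -/D -/X; congr (_ *m _).
  by rewrite -mulmxA -!scalemxAr (mulKVmx Du).
have FJ2 : flattening T graft *m (flattening T graft)^t* =
    (k' * (frobsq M / normsq z)) *: ((X *m y) *m (X *m y)^t*).
  have tr_xi : xi^T *m (xi^T)^t* = k'%:M.
    rewrite -xiE [LHS]mx11_scalar; congr (_%:M).
    by rewrite /normsq !mxE; apply: eq_bigr => a _; rewrite !mxE mulrC.
  rewrite FJ ctmxM ctmxZ; have -> : c *: (X *m y) *m xi^T *m ((xi^T)^t* *m (Num.conj c *: (X *m y)^t*)) =
    (c *: (X *m y)) *m (xi^T *m (xi^T)^t*) *m (Num.conj c *: (X *m y)^t*).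
    by rewrite !mulmxA.
  rewrite tr_xi mul_mx_scalar -!(scalemxAl, scalemxAr) !scalerA -c2 normCK.
  by congr (_ *: _); ring.
have sXy : normsq (X *m y) = k * normsq z by rewrite (normsq_gram GX) By.
have rank1_trace n (v : 'cV[C]_n) N : \tr (v *m v^t* *m N) = (v^t* *m N *m v) 0 0.
  by rewrite -mulmxA mxtrace_mulC /mxtrace big_ord1.
have NJ : norm2sq graft = norm2sq psi.
  rewrite (norm2sq_trace T) FJ2 mxtraceZ -[X in \tr X]mulmx1 rank1_trace mulmx1.
  rewrite -/(normsq _) sXy NE; field; rewrite gt_eqF //.
split=> //; first by move=> j i; exact: bell_filter1.
rewrite /reduced_density NJ FJ2 -!(scalemxAl, scalemxAr) !mxtraceZ rank1_trace.
have -> : ((X *m y)^t* *m (flattening T psi *m (flattening T psi)^t*) *m (X *m y)) 0 0 =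
  k ^+ 2 * k' * normsq (M^t* *m z).
  by rewrite -Fv /normsq !ctmxM trmxCK !mulmxA.
rewrite NE.
have -> : (k * k' * frobsq M)^-1 * (k' * (frobsq M / normsq z) *
   ((k * k' * frobsq M)^-1 * (k ^+ 2 * k' * normsq (M^t* *m z)))) = normsq (M^t* *m z) / (frobsq M * normsq z).
  move: kk; rewrite mulf_eq0 negb_or => /andP[k0 k'0].
  by field; rewrite k0 k'0 fM0 gt_eqF.
have fM : 0 < frobsq M by rewrite lt_neqAle eq_sym fM0 frobsq_ge0.
by rewrite ler_pdivrMr ?mulr_gt0 // mulrA.
Qed.

End Crossed.

(** * Functionals of bipartitions *)

Section Functional.
Variables (R : realType) (k : nat).
Local Notation C := R[i].
Local Notation log x := (ln x / ln 2).

(** The side that [bip_entropy] picks. *)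
Definition side (b : bipartition k) : {set 'I_k} :=
  odflt finset.set0 [pick A in val b].

Lemma side_in b : side b \in val b.
Proof.
rewrite /side; case: pickP => [A //|none].
have /fintype.existsP [S /and3P[_ _ /eqP e]] := valP b.
by have := none S; rewrite e !inE eqxx.
Qed.

Lemma val_sideE b : val b = [set side b; ~: side b].
Proof.
have := side_in b; have /fintype.existsP [S /and3P[_ _ /eqP ->]] := valP b.
rewrite !inE => /orP[] /eqP -> //.
by rewrite finset.setCK finset.setUC.
Qed.

Lemma side_proper b : (side b != finset.set0) && (~: side b != finset.set0).
Proof.
have := side_in b; have /fintype.existsP [S /and3P[S0 S1 /eqP ->]] := valP b.
have SC : ~: S != finset.set0.
  by apply: contra S1 => /eqP e; rewrite -[S]finset.setCK e finset.setC0.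
by rewrite !inE => /orP[] /eqP ->; rewrite ?finset.setCK ?S0 ?SC.
Qed.

Lemma nonsingleton_side b : ~~ singleton_bipartition b ->
  (1 < #|side b|)%N && (1 < #|~: side b|)%N.
Proof.
rewrite negb_exists => /fintype.forallP ns.
have /andP[s0 s1] := side_proper b.
have h A : A \in val b -> A != finset.set0 -> (1 < #|A|)%N.
  move=> Ab A0; have := ns A; rewrite Ab /= => A1.
  by rewrite ltn_neqAle eq_sym A1 card_gt0.
by rewrite !h // val_sideE !inE eqxx ?orbT.
Qed.

Lemma bip_entropyE d b (psi : tensor R d) :
  bip_entropy b psi = side_entropy (side b) psi.
Proof.
rewrite /bip_entropy /side; case: pickP => // none.
by have := side_in b; rewrite none.
Qed.

Variable theta : bipartition k -> R.
Hypothesis theta_ge0 : forall b, 0 <= theta b.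

Lemma mean_entropy_le d (psi : tensor R d) (u : bipartition k -> R) :
  (forall b, side_entropy (side b) psi <= u b) ->
  mean_entropy theta psi <= \sum_b theta b * u b.
Proof.
move=> h; apply: ler_sum => b _; rewrite bip_entropyE.
exact: ler_wpM2l.
Qed.

Lemma max_entropy_le d (psi : tensor R d) (u : bipartition k -> R) : psi != 0 ->
  (forall phi b, phi != 0 -> side_entropy (side b) (phi : tensor R d) <= u b) ->
  max_entropy theta psi <= \sum_b theta b * u b.
Proof.
move=> p0 h; apply: ge_sup.
  by exists (mean_entropy theta (tact (fun=> 1%:M) psi)); exists (fun=> 1%:M) => // i; exact: unitmx1.
move=> _ [A Au ->]; apply: mean_entropy_le => b; apply: h.
exact: tact_unit_neq0.
Qed.

Lemma max_entropy_has_sup d (psi : tensor R d) : psi != 0 ->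
  has_sup [set h | exists2 A : forall i, 'M[R[i]]_(d i),
                 (forall i, A i \in unitmx) & h = mean_entropy theta (tact A psi)]%classic.
Proof.
move=> p0; split.
  by exists (mean_entropy theta (tact (fun=> 1%:M) psi)); exists (fun=> 1%:M) => // i; exact: unitmx1.
exists (\sum_b theta b * log #|{: multi_index (@leg_dim 'I_k d (side b))}|%:R).
move=> _ [A Au ->]; apply: mean_entropy_le => b; apply: side_entropy_le.
exact: tact_unit_neq0.
Qed.

Lemma mean_entropy_le_max d (psi : tensor R d) : psi != 0 ->
  mean_entropy theta psi <= max_entropy theta psi.
Proof.
move=> /max_entropy_has_sup hs; apply: ub_le_sup; first by case: hs.
exists (fun=> 1%:M); first by move=> i; exact: unitmx1.
by rewrite (tact1 psi).
Qed.

Lemma max_entropy_attained d (psi : tensor R d) eps : psi != 0 -> 0 < eps ->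
  exists2 A : forall i, 'M[R[i]]_(d i), (forall i, A i \in unitmx) &
    max_entropy theta psi - eps < mean_entropy theta (tact A psi).
Proof.
move=> /max_entropy_has_sup hs eps0.
by have [_ [A Au ->] lt] := sup_adherent eps0 hs; exists A.
Qed.

End Functional.

Section Separation.
Variables (R : realType) (k : nat).
Local Notation C := R[i].
Local Notation log x := (ln x / ln 2).
Variables i1 i2 : 'I_k.
Hypothesis i12 : i1 != i2.
Let flagged : {set 'I_k} := [set i1; i2].

Definition cuts (A : {set 'I_k}) : bool :=
  ~~ [disjoint A & flagged] && ~~ [disjoint ~: A & flagged].

Lemma flagged_meets (A : {set 'I_k}) : [disjoint A & flagged] -> ~~ [disjoint ~: A & flagged].
Proof.
move=> /disjointFl AF; apply/pred0Pn; exists i1 => /=.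
by rewrite !inE eqxx AF // !inE eqxx.
Qed.

Lemma cutsPn A : ~~ cuts A -> [disjoint A & flagged] || [disjoint ~: A & flagged].
Proof. by rewrite negb_and !negbK. Qed.

Lemma card_epr_legs n (A : {set 'I_k}) :
  #|{: multi_index (@leg_dim 'I_k (flag_dim flagged n) A)}| =
  (\prod_(i in A) flag_dim flagged n i)%N.
Proof. by rewrite card_multi_index [RHS]big_sub. Qed.

Lemma cutsP A : cuts A -> exists2 i, i \in A & forall j, j \in A -> j \in flagged -> j = i.
Proof.
move=> /andP[/pred0Pn[i /andP[/= iA iF]] /pred0Pn[j /andP[/= jA jF]]].
exists i => // l lA lF; move: iF jF lF; rewrite !inE in jA *.
move=> /orP[]/eqP ei /orP[]/eqP ej /orP[]/eqP el; rewrite ?ei ?el //;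
  by move: iA lA jA; rewrite ei ej el => h1 h2; rewrite ?h1 ?h2.
Qed.

(** A side has dimension n.+1 if it contains exactly one of i1 and i2, and
    dimension 1 if it contains none of them; otherwise pass to the complement. *)
Lemma side_entropy_epr n (phi : tensor R (flag_dim flagged n)) A : phi != 0 ->
  side_entropy A phi <= (cuts A)%:R * log n.+1%:R.
Proof.
move=> p0; have [cA|] := boolP (cuts A).
  rewrite mul1r; apply: le_trans (side_entropy_le A p0) _.
  have [i iA iu] := cutsP cA.
  rewrite card_epr_legs (bigD1 i) //= big1 ?muln1 => [|j /andP[jA ji]].
    rewrite ler_pM2r ?invr_gt0 ?ln2_gt0 // ler_ln ?posrE ?ltr0n // ler_nat.
    by rewrite /flag_dim; case: ifP.
  rewrite /flag_dim; case: ifP => // jF.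
  by rewrite (iu j) ?eqxx in ji.
move=> /cutsPn; rewrite mul0r.
wlog AF : A / [disjoint A & flagged].
  move=> hw /orP[AF|AF]; first by apply: hw; rewrite ?AF.
  by rewrite -side_entropyC; apply: hw; rewrite ?AF.
move=> _; apply: le_trans (side_entropy_le A p0) _.
rewrite card_epr_legs big1 ?ln1 ?mul0r // => j jA.
by rewrite /flag_dim (disjointFr AF jA).
Qed.

End Separation.

(** * The grafted tensor contradicts spectrality *)

Section Main.
Variables (R : realType) (k : nat) (theta : bipartition k -> R).
Local Notation C := R[i].
Local Notation log x := (ln x / ln 2).
Hypothesis theta_ge0 : forall b, 0 <= theta b.
Hypothesis theta_sum : \sum_b theta b = 1.
Variables i1 i2 i3 i4 : 'I_k.
Hypothesis i12 : i1 != i2.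
Hypothesis i34 : i3 != i4.
Variable b0 : bipartition k.
Hypothesis T1 : i1 \notin side b0.
Hypothesis T2 : i2 \notin side b0.
Hypothesis T3 : i3 \in side b0.
Hypothesis T4 : i4 \in side b0.
Let flagged : {set 'I_k} := [set i1; i2].

Definition cut_mass : R := \sum_b theta b * (cuts i1 i2 (side b))%:R.

Lemma cut_mass_ge0 : 0 <= cut_mass.
Proof. by apply: sumr_ge0 => b _; rewrite mulr_ge0 ?ler0n. Qed.

Lemma cut_mass_le1 : cut_mass <= 1.
Proof. by rewrite -theta_sum; apply: ler_sum => b _; rewrite ler_piMr // lern1 leq_b1. Qed.

Lemma qubit_max_entropy_le (psi : tensor R (fun _ : 'I_k => 2%N)) : psi != 0 ->
  max_entropy theta psi <= k%:R.
Proof.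
move=> p0; apply: (@le_trans _ _ (\sum_b theta b * k%:R)); last first.
  by rewrite -mulr_suml theta_sum mul1r.
apply: max_entropy_le => // phi b phi0.
apply: le_trans (side_entropy_le _ phi0) _.
rewrite card_multi_index prod_nat_const natrX lnXn ?ltr0n // -[X in X / _]mulr_natl.
rewrite mulfK ?gt_eqF ?ln2_gt0 //.
by rewrite ler_nat -[X in (_ <= X)%N](card_ord k) card_sig max_card.
Qed.

Lemma log_1Dp_le1 (p : R) : 0 < p -> p <= 1 -> log (1 + p) <= 1.
Proof.
move=> p0 p1; rewrite ler_pdivrMr ?ln2_gt0 // mul1r ler_ln ?posrE //; lra.
Qed.

(** The term p pays for the sides that do not separate i1 from i2, where the trace
    in [entropy_mix] is only known to be at most 1 + p; on the side of b0 it is at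
    most p + p, and the last term is a gain because p + p is small. *)
Lemma mean_entropy_flag_sum q' (A : 'I_k -> 'M[C]_2) :
  (0 < q')%N -> (forall i, A i \in unitmx) ->
  let p : R := q'.+1%:R^-1 in
  let psi := tact A (crossed i1 i2 i3 i4 p%:C) in
  exists Psi : tensor R (fun i => 2 * flag_dim flagged q' i)%N,
    [/\ Psi != 0, restricts Psi (tkron psi (epr R flagged q'.+1)) &
      (1 - p) * mean_entropy theta psi + cut_mass * log q'.+1%:R - p
        - theta b0 * p * log (p + p) <= mean_entropy theta Psi].
Proof.
move=> q0 Au p psi.
have p0 : 0 < p by rewrite invr_gt0 ltr0n.
have p1 : p < 1 by rewrite invf_lt1 ?ltr0n // ltr1n ltnS.
have [L [L1 graft_norm trace_le]] := graft_exists i12 i34 T1 T2 T3 T4 Au p0.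
rewrite -/psi in graft_norm trace_le.
set graft := \sum_j _ in graft_norm trace_le.
have psi0 : psi != 0 by apply: tact_unit_neq0 => //; exact: (crossed_neq0 _ i12 T2 T3).
pose W (f : 'I_q'.+1) := @flag_iso R 'I_k (fun=> 2%N) flagged q' f.
have W_iso f i : (W f i)^t* *m W f i = 1%:M by rewrite flag_isoM eqxx.
have W_ortho f g i : f != g -> i \in flagged -> (W f i)^t* *m W g i = 0.
  by move=> fg iF; apply: flag_iso_ortho => //; rewrite -ltnS.
have W_const f g i : i \notin flagged -> W f i = W g i by exact: flag_iso_const.
have TF : [disjoint side b0 & flagged].
  rewrite disjoint_sym; apply/pred0P => i /=; rewrite !inE.
  by apply/negP => /andP[/orP[]/eqP ->]; apply/negP.
exists (flag_sum W psi graft); split.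
- exact: (flag_sum_neq0 W_iso W_ortho psi0 graft_norm (flagged_meets TF)).
- exact: (@restricts_flag_sum R 'I_k _ flagged q' psi graft L L1 erefl).
have uncut (A' : {set 'I_k}) x : [disjoint A' & flagged] -> 0 <= x ->
    \tr (reduced_density A' graft *m reduced_density A' psi) <= x%:C ->
    (1 - p) * side_entropy A' psi - p * log (x + p) <= side_entropy A' (flag_sum W psi graft).
  move=> AF; exact: (side_entropy_uncut W_iso W_ortho W_const psi0 graft_norm q0 AF (flagged_meets AF)).
have graft0 : graft != 0 by rewrite -norm2sq_eq0 graft_norm norm2sq_eq0.
have uncut1 (A' : {set 'I_k}) : [disjoint A' & flagged] ->
    (1 - p) * side_entropy A' psi - p <= side_entropy A' (flag_sum W psi graft).
  move=> AF; apply: le_trans (uncut A' 1 AF ler01 _); last first.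
    by apply: trace_mul_psd; rewrite ?trace_reduced_density //; exact: psd_reduced_density.
  by rewrite lerD2l lerN2 ler_piMr ?(ltW p0) // log_1Dp_le1 // ltW.
pose gain b : R := - (b == b0)%:R * (p * log (p + p)).
have bound b : (1 - p) * side_entropy (side b) psi +
    (cuts i1 i2 (side b))%:R * log q'.+1%:R - p + gain b <=
    side_entropy (side b) (flag_sum W psi graft).
  have [->|bb0] := eqVneq b b0.
    rewrite /gain eqxx /cuts TF /= mul0r addr0 mulN1r.
    have := uncut _ p TF (ltW p0) trace_le; lra.
  rewrite /gain (negPf bb0) oppr0 mul0r addr0.
  have [cA|] := boolP (cuts i1 i2 (side b)).
    have /andP[c1 c2] := cA; rewrite mul1r.
    have := side_entropy_cut W_iso W_ortho psi0 graft_norm c1 c2.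
    by rewrite -/p; lra.
  move=> /cutsPn /orP[AF|AF]; rewrite mul0r addr0; first exact: uncut1.
  by rewrite -!(side_entropyC (side b)); exact: uncut1.
have : \sum_b theta b * ((1 - p) * side_entropy (side b) psi +
    (cuts i1 i2 (side b))%:R * log q'.+1%:R - p + gain b) <=
  mean_entropy theta (flag_sum W psi graft).
  by apply: ler_sum => b _; rewrite bip_entropyE ler_wpM2l.
apply: le_trans; rewrite le_eqVlt; apply/orP; left; apply/eqP.
rewrite [RHS](eq_bigr (fun b => (1 - p) * (theta b * bip_entropy b psi) +
    theta b * (cuts i1 i2 (side b))%:R * log q'.+1%:R - theta b * p +
    theta b * gain b)); last by move=> b _; rewrite bip_entropyE; ring.
rewrite !big_split /= -mulr_sumr sumrN -!mulr_suml theta_sum mul1r.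
congr (_ + _).
rewrite (bigD1 b0) //= big1 => [|b bb0]; rewrite /gain.
  by rewrite eqxx addr0 mulN1r mulrN !mulrA.
by rewrite (negPf bb0) oppr0 mul0r mulr0.
Qed.

Lemma le_of_powR2 (x y : R) : 2 `^ x <= 2 `^ y -> x <= y.
Proof.
have t0 z : 0 < 2 `^ z :> R by rewrite powR_gt0.
move=> xy; have : ln (2 `^ x) <= ln (2 `^ y) :> R by rewrite ler_ln ?posrE.
by rewrite !ln_powR ler_pM2r // ln2_gt0.
Qed.

Lemma ln_succ_le (n : nat) : ln n.+2%:R <= ln n.+1%:R + n.+1%:R^-1 :> R.
Proof.
apply: le_trans (ln_le_tangent _ _ : _ <= ln n.+1%:R + _ / n.+1%:R - 1) _.
- by rewrite ltr0n.
- by rewrite ltr0n.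
rewrite -(natr1 n.+1) mulrDl mul1r mulfV ?pnatr_eq0 //.
by move: (ln _) (_^-1) => a b; lra.
Qed.

(** The arithmetic of the comparison.  Y is the gain, E and Mpsi the maximal
    entropies of D and of psi, m and mPsi the mean entropies of psi and of Psi, and
    v, u the values t log q and t log (q + 1). *)
Lemma budget (p E K Y m u v w MPsi MX Mpsi mPsi : R) : 0 < p -> p < 1 -> E <= K ->
  E - p < m -> (1 - p) * m + v - p + Y <= mPsi -> mPsi <= MPsi ->
  MPsi <= Mpsi + MX -> Mpsi <= E -> MX <= u -> u <= v + p * w ->
  Y <= p * (K + 2 + w).
Proof.
move=> p0 p1 EK Em low le1 le2 le3 le4 le5.
have h1 : (1 - p) * (E - p) <= (1 - p) * m.
  by apply: ler_wpM2l; [rewrite subr_ge0 ltW | exact: ltW].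
have h2 : p * E <= p * K by rewrite ler_pM2l.
have h3 : 0 <= p * p by rewrite mulr_ge0 ?(ltW p0).
rewrite !mulrDr; lra.
Qed.

Hypothesis spec : spectral_point (lower_functional theta).

Lemma spectral_inequality q' : (0 < q')%N ->
  theta b0 * ln (q'.+1%:R / 2) <= (k%:R + 2) * ln 2 + 1.
Proof.
move=> q0; pose p : R := q'.+1%:R^-1.
have p0 : 0 < p by rewrite invr_gt0 ltr0n.
have p1 : p < 1 by rewrite invf_lt1 ?ltr0n // ltr1n ltnS.
pose D := crossed i1 i2 i3 i4 p%:C.
have D0 : D != 0 by exact: (crossed_neq0 _ i12 T2 T3).
have [A Au near_max] := max_entropy_attained theta_ge0 D0 p0.
have psi0 : tact A D != 0 by exact: tact_unit_neq0.
have [Psi [Psi0 res low]] := mean_entropy_flag_sum q0 Au.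
rewrite -/p -/D in res low.
have X0 := epr_neq0 R flagged q'.+1.
pose kD := KTensor D0; pose kpsi := KTensor psi0; pose kX := KTensor X0.
pose kPsi := KTensor Psi0.
have F1 : lower_functional theta kPsi <= lower_functional theta (kmul kpsi kX).
  by apply: (spectral_mono spec); exact: res.
have F2 : lower_functional theta kpsi <= lower_functional theta kD.
  by apply: (spectral_mono spec); exists A.
rewrite (spectral_mul spec) /lower_functional -powRD ?pnatr_eq0 ?implybT // in F1.
have E1 := le_of_powR2 F1; have E2 := le_of_powR2 F2.
rewrite /= in E1 E2.
have EX : max_entropy theta (epr R flagged q'.+1) <= cut_mass * log q'.+2%:R.
  apply: (@le_trans _ _ (\sum_b theta b * ((cuts i1 i2 (side b))%:R * log q'.+2%:R))).
    by apply: max_entropy_le => // phi b phi0; exact: side_entropy_epr.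
  by rewrite /cut_mass mulr_suml; under eq_bigr do rewrite mulrA.
have EPsi := mean_entropy_le_max theta_ge0 Psi0.
have Ek := qubit_max_entropy_le D0.
have t0 := cut_mass_ge0; have t1 := cut_mass_le1.
have l0 : 0 < ln 2 :> R := ln2_gt0 R.
have ln2p : ln (p + p) = - ln (q'.+1%:R / 2) :> R.
  rewrite -lnV ?posrE ?divr_gt0 ?ltr0n // invf_div -/p; congr ln.
  by rewrite mulr_natl mulr2n.
have step : cut_mass * log q'.+2%:R <= cut_mass * log q'.+1%:R + p * (ln 2)^-1.
  rewrite -lerBlDl -mulrBr -mulrBl; apply: (@le_trans _ _ (cut_mass * (p / ln 2))).
    by rewrite ler_wpM2l // ler_pM2r ?invr_gt0 // lerBlDl; exact: ln_succ_le.
  by rewrite ler_piMl // divr_ge0 ?ltW.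
have := budget p0 p1 Ek near_max low EPsi E1 E2 EX step.
rewrite ln2p mulNr mulrN opprK.
have l0' : 0 < (ln 2)^-1 :> R by rewrite invr_gt0.
move=> h; rewrite -(ler_pM2l p0) -(ler_pM2r l0').
have -> : p * (theta b0 * ln (q'.+1%:R / 2)) / ln 2 =
    theta b0 * p * log (q'.+1%:R / 2) by ring.
suff -> : p * ((k%:R + 2) * ln 2 + 1) / ln 2 = p * (k%:R + 2 + (ln 2)^-1) by [].
by field; rewrite gt_eqF.
Qed.

Lemma spectral_contradiction : 0 < theta b0 -> False.
Proof.
move=> th0; pose K : R := ((k%:R + 2) * ln 2 + 1) / theta b0.
(* Any q.+1 > 2 exp K violates the inequality, as ln ((q + 1) / 2) > K. *)
pose q := (Num.truncn (2 * expR K)).+1.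
have qK : 2 * expR K < q.+1%:R.
  apply: (@lt_le_trans _ _ q%:R); last by rewrite ler_nat.
  by rewrite truncnS_gt.
have := @spectral_inequality q isT; rewrite mulrC -ler_pdivlMr // -/K leNgt.
rewrite -[X in X < _]expRK ltr_ln ?posrE ?expR_gt0 ?divr_gt0 ?ltr0n //.
by rewrite ltr_pdivlMr // mulrC qK.
Qed.

End Main.

Local Open Scope classical_set_scope.

Theorem theorem3p14 (R : realType) (k : nat) (theta : bipartition k -> R) :
  (4 <= k)%N ->
  (distributions R k `\` singleton_distributions R k) theta ->
  ~ spectral_point (lower_functional theta).
Proof.
move=> _ [[theta0 theta1] not_single] spec.
have [b0 b0n ns] : exists2 b, theta b != 0 & ~~ singleton_bipartition b.
  apply: contrapT => h; apply: not_single; split=> // b b0.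
  by apply: contrapT => /negP ns; apply: h; exists b.
have /andP[/card_gt1P[i3 [i4 [T3 T4 i34]]] /card_gt1P[i1 [i2 [T1 T2 i12]]]] :=
  nonsingleton_side ns.
rewrite !inE in T1 T2.
apply: (spectral_contradiction theta0 theta1 i12 i34 T1 T2 T3 T4 spec).
by rewrite lt_neqAle eq_sym b0n theta0.
Qed.
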